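(* Let $s \geq 1$, $d \geq 1$ and let $\omega$ be a measurable subset of $\mathbb{R}^d$. If the fractional harmonic Schrödinger equation $$\left\lbrace \begin{array}{ll} \partial_t f(t,x) + i(-\Delta_x+|x|^2)^s f(t,x)=u(t,x)\mathbf{1}_{\omega}(x), & x \in \mathbb{R}^d,\ t>0,\\ f|_{t=0}=f_0 \in L^2(\mathbb{R}^d),& \end{array}\right.$$ is exactly controllable from $\omega$ in time $T$ for some $T>0$, then $$\forall A \in O(\mathbb{R}^d), \quad \liminf_{R_1 \to +\infty}\cdots\liminf_{R_d \to +\infty} \frac{|A(\omega) \cap ([-R_1,R_1] \times \cdots \times [-R_d,R_d])|}{|[-R_1,R_1] \times \cdots \times [-R_d,R_d]|} >0,$$ where $O(\mathbb{R}^d)$ denotes the orthogonal group in dimension $d$.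
   Context: $|E|$ denotes the Lebesgue measure of a measurable set $E$, $|x|$ the Euclidean norm of $x\in\mathbb{R}^d$, and $\mathbf{1}_\omega$ the indicator function of $\omega$. The liminf is iterated: first (innermost) in $R_d$, then $R_{d-1}$, and so on, finally in $R_1$. Hermite functions: $\psi_n(x)=\pi^{-1/4}2^{-n/2}(n!)^{-1/2}e^{-x^2/2}H_n(x)$, $n\ge 0$, $x \in \mathbb{R}$, where $H_n(x)=(-1)^n e^{x^2}\frac{d^n}{dx^n}e^{-x^2}$ is the Hermite polynomial of degree $n$. For $\alpha=(\alpha_1,\dots,\alpha_d)\in\mathbb{N}^d$ (with $0\in\mathbb{N}$), $\Psi_\alpha(x)=\prod_{i=1}^d\psi_{\alpha_i}(x_i)$ and $|\alpha|=\alpha_1+\cdots+\alpha_d$; $(\Psi_\alpha)_{\alpha\in\mathbb{N}^d}$ is a Hilbert basis of $L^2(\mathbb{R}^d)$. The fractional harmonic oscillator $(-\Delta_x+|x|^2)^s$, $s>0$, is the selfadjoint operator on $L^2(\mathbb{R}^d)$ with domain $\{f \in L^2(\mathbb{R}^d) : \sum_{\alpha}(2|\alpha|+d)^{2s}|\langle f,\Psi_\alpha\rangle_{L^2(\mathbb{R}^d)}|^2<+\infty\}$ and $(-\Delta_x+|x|^2)^s f=\sum_{\alpha}(2|\alpha|+d)^s\langle f,\Psi_\alpha\rangle_{L^2(\mathbb{R}^d)}\Psi_\alpha$. Exact controllability: let $P$ be a selfadjoint operator on $L^2(\mathbb{R}^d)$ and $T>0$. The equation $\partial_t f+iPf=u\mathbf{1}_\omega$,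 $f|_{t=0}=f_0$, is exactly controllable from $\omega$ in time $T$ if for all $f_0,f_T \in L^2(\mathbb{R}^d)$ there exists $u \in L^2((0,T)\times\mathbb{R}^d)$, supported in $(0,T)\times\omega$, such that the mild solution $f(t)=e^{-itP}f_0+\int_0^t e^{-i(t-\tau)P}(\mathbf{1}_\omega u(\tau,\cdot))\,d\tau$ satisfies $f(T,\cdot)=f_T$. Here $P=(-\Delta_x+|x|^2)^s$. *)

(* Defs.v *)
From HB Require Import structures.
From mathcomp Require Import all_boot all_order all_algebra finmap.
From mathcomp Require Import complex.
From mathcomp Require Import all_classical all_reals all_analysis.

Set Implicit Arguments.
Unset Strict Implicit.
Unset Printing Implicit Defensive.

Import Order.TTheory GRing.Theory Num.Theory.
Import numFieldNormedType.Exports.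

Local Open Scope classical_set_scope.
Local Open Scope ring_scope.
Local Open Scope complex_scope.

Section pushforward_sigma_finite.
Context d1 d2 (T1 : measurableType d1) (T2 : measurableType d2) (R : realType).
Variables (m : set T1 -> \bar R) (f : T1 -> T2) (g : T2 -> T1).
Hypotheses (sm : sigma_finite setT m) (mg : measurable_fun setT g).
Hypothesis (fK : cancel f g).

Lemma sigma_finite_pushforward : sigma_finite setT (pushforward m f).
Proof.
have [F FT mF] := sm.
exists (fun i => g @^-1` F i).
  by rewrite -preimage_bigcup -FT preimage_setT.
move=> i; split.
  by rewrite -[X in measurable X]setTI; apply: mg => //; case: (mF i).
rewrite /pushforward -comp_preimage.
have -> : g \o f = id by apply/funext => x /=; rewrite fK.
by case: (mF i).
Qed.

End pushforward_sigma_finite.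

Section product_sigma_finite.
Context d1 d2 (T1 : measurableType d1) (T2 : measurableType d2) (R : realType).
Variable m1 : {sigma_finite_measure set T1 -> \bar R}.
Variable m2 : {sigma_finite_measure set T2 -> \bar R}.

Lemma sigma_finite_product : sigma_finite setT (m1 \x m2)%E.
Proof.
have /sigma_finiteP[F [TF ndF Foo]] := sigma_finiteT m1.
have /sigma_finiteP[G [TG ndG Goo]] := sigma_finiteT m2.
exists (fun n => F n `*` G n).
  rewrite -setXTT TF TG predeqE => -[x y]; split.
    move=> [/= [n _ Fnx] [k _ Gky]]; exists (maxn n k) => //; split.
    - by move: x Fnx; exact/subsetPset/ndF/leq_maxl.
    - by move: y Gky; exact/subsetPset/ndG/leq_maxr.
  by move=> [n _ []/= ? ?]; split; exists n.
move=> k; have [? ?] := Foo k; have [? ?] := Goo k.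
split; first exact: measurableX.
by rewrite product_measure1E// lte_mul_pinfty// ge0_fin_numE.
Qed.

End product_sigma_finite.

(* Borel-Lebesgue measure on R^n, by recursion on n: the point mass on R^0, and
   the image of the product measure under R * R^n ~ R^(n+1). *)
Section borel_lebesgue.
Variable R : realType.

Definition cons_pair n (p : measurableTypeR R * n.-tuple R) : n.+1.-tuple R :=
  [tuple of p.1 :: p.2].

Definition uncons_pair n (t : n.+1.-tuple R) : measurableTypeR R * n.-tuple R :=
  (thead t, [tuple of behead t]).

Lemma cons_pairK n : cancel (@cons_pair n) (@uncons_pair n).
Proof.
by move=> [x t]; congr pair; exact: val_inj.
Qed.

Lemma measurable_cons_pair n : measurable_fun setT (@cons_pair n).
Proof.
exact: (@measurable_cons _ _ (measurableTypeR R * n.-tuple R)%type R fst n snd).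
Qed.

Lemma measurable_uncons_pair n : measurable_fun setT (@uncons_pair n).
Proof.
apply: measurable_fun_pair.
  exact: (@measurable_tnth _ R n.+1 ord0).
exact: measurable_behead.
Qed.

Section step.
Variables (n : nat) (m : {sigma_finite_measure set (n.-tuple R) -> \bar R}).

Definition lebesgue_step : set (n.+1.-tuple R) -> \bar R :=
  pushforward (lebesgue_measure \x m)%E (@cons_pair n).

HB.instance Definition _ := Measure.copy lebesgue_step
  (measure_function_pushforward__canonical__measure_function_Measure
    (lebesgue_measure \x m)%E (@measurable_cons_pair n)).

Let lebesgue_step_sigma_finite : sigma_finite setT lebesgue_step.
Proof.
exact: (sigma_finite_pushforward (sigma_finite_product _ m)
  (@measurable_uncons_pair n) (@cons_pairK n)).
Qed.

HB.instance Definition _ := Measure_isSigmaFinite.Build _ _ _ lebesgue_step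
  lebesgue_step_sigma_finite.

End step.

Fixpoint borel_lebesgue n : {sigma_finite_measure set (n.-tuple R) -> \bar R} :=
  match n with
  | 0 => \d_([tuple] : 0.-tuple R)
  | n.+1 => lebesgue_step (borel_lebesgue n)
  end.

End borel_lebesgue.

(* [euclidean R d] is d.-tuple R equipped with the sigma-algebra of all
   Lebesgue-measurable sets, i.e. the completion of the Borel one;
   [lebesgue d] is the Lebesgue measure on it. *)
Section lebesgue.
Variables (R : realType) (d : nat).

Definition euclidean := caratheodory_type (borel_lebesgue R d)^*%mu.

HB.instance Definition _ := Measurable.on euclidean.

Definition lebesgue : set euclidean -> \bar R :=
  @completed_measure_extension _ _ _ (borel_lebesgue R d).

HB.instance Definition _ := Measure.on lebesgue.

Let lebesgue_sigma_finite : sigma_finite setT lebesgue.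
Proof. exact/completed_measure_extension_sigma_finite/sigma_finiteT. Qed.

HB.instance Definition _ := Measure_isSigmaFinite.Build _ _ _ lebesgue
  lebesgue_sigma_finite.

End lebesgue.

(* Elements of L^2(mu; C) are represented by functions, so equality in L^2 is
   equality mu-almost everywhere. *)
Section complex_L2.
Context d (T : measurableType d) (R : realType).
Variable mu : {measure set T -> \bar R}.
Implicit Types f g : T -> R[i].

Definition L2norm f : \bar R :=
  Lnorm mu 2%:E (fun x => (Normc.normc (f x))%:E).

Definition L2 f : Prop :=
  [/\ measurable_fun setT (fun x => complex.Re (f x)),
      measurable_fun setT (fun x => complex.Im (f x)) & (L2norm f < +oo)%E].

Definition complex_integral f : R[i] :=
  (\int[mu]_x complex.Re (f x)) +i* (\int[mu]_x complex.Im (f x)).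

Definition L2inner f g : R[i] := complex_integral (fun x => f x * (g x)^*).

(* sum of a family in L^2, as a limit over the net of finite partial sums *)
Definition L2_has_sum (I : choiceType) (F : I -> T -> R[i]) g : Prop :=
  forall e : R, 0 < e -> exists A0 : {fset I}, forall A : {fset I},
    (A0 `<=` A)%fset ->
    (L2norm (fun x => (g x - \sum_(i <- A) F i x)%R) < e%:E)%E.

(* the Bochner integral over D of the L^2-valued function W is g: the functions
   \sum_k 1_(E n k) h n k are simple functions approximating W *)
Definition is_bochner_integral (D : set (measurableTypeR R))
    (W : R -> T -> R[i]) g : Prop :=
  L2 g /\
  exists (m : nat -> nat) (E : nat -> nat -> set (measurableTypeR R))
         (h : nat -> nat -> T -> R[i]),
    let S n t x := \sum_(k < m n) (\1_(E n k) t)%:C * h n k x in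
    [/\ forall n k, [/\ measurable (E n k), E n k `<=` D,
          (lebesgue_measure (E n k) < +oo)%E & L2 (h n k)],
        {ae lebesgue_measure, forall t, D t ->
          L2norm (fun x => W t x - S n t x) @[n --> \oo] --> 0%E},
        (\int[lebesgue_measure]_(t in D) L2norm (fun x => (W t x - S n t x)%R))%E
          @[n --> \oo] --> 0%E
      & L2norm (fun x => g x - \sum_(k < m n)
            (fine (lebesgue_measure (E n k)))%:C * h n k x)
          @[n --> \oo] --> 0%E].

End complex_L2.

Section hermite.
Variable R : realType.

Definition hermite_polynomial (n : nat) (x : R) : R :=
  (-1) ^+ n * expR (x ^+ 2) * derive1n n (fun y : R => expR (- y ^+ 2)) x.

Definition hermite_function (n : nat) (x : R) : R :=
  pi `^ (- 4^-1) * 2 `^ (- (n%:R / 2)) * n`!%:R `^ (- 2^-1)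
  * expR (- (x ^+ 2 / 2)) * hermite_polynomial n x.

Variable d : nat.
Implicit Types a : {ffun 'I_d -> nat}.

Definition hermite_tensor a (x : euclidean R d) : R[i] :=
  (\prod_(i < d) hermite_function (a i) (tnth x i))%:C.

Definition multi_degree a : nat := (\sum_(i < d) a i)%N.

(* [frac_harmonic_calculus s phi f g] means g = phi(P) f, where P is the
   operator (-Delta + |x|^2)^s, diagonal in the Hermite basis with eigenvalues
   (2|a| + d)^s: the series of the phi((2|a| + d)^s) <f, Psi_a> Psi_a converges
   in L^2 to g. For phi the inclusion of R in C this is the graph of P. *)
Definition frac_harmonic_calculus (s : R) (phi : R -> R[i])
    (f g : euclidean R d -> R[i]) : Prop :=
  [/\ L2 (@lebesgue R d) f, L2 (@lebesgue R d) g &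
      L2_has_sum (@lebesgue R d)
        (fun a x => phi ((2 * multi_degree a + d)%:R `^ s)
                    * L2inner (@lebesgue R d) f (hermite_tensor a)
                    * hermite_tensor a x) g].

Definition expi (t : R) : R[i] := cos t +i* sin t.

(* e^{-itP} *)
Definition frac_harmonic_group (s t : R) :=
  frac_harmonic_calculus s (fun l => expi (- (t * l))).

End hermite.

Section control.
Variables (R : realType) (d : nat).
Local Notation X := (euclidean R d).
Local Notation mu := (@lebesgue R d).

(* U t is (the graph of) e^{-itP} *)
Variable U : R -> (X -> R[i]) -> (X -> R[i]) -> Prop.
Variable omega : set X.

(* f(t) = e^{-itP} f0 + \int_0^t e^{-i(t-tau)P} (1_omega u(tau)) dtau *)
Definition is_mild_solution (f0 : X -> R[i]) (u : measurableTypeR R * X -> R[i]) (T : R)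
    (f : R -> X -> R[i]) : Prop :=
  forall t, 0 <= t <= T -> exists (a b : X -> R[i]) (W : R -> X -> R[i]),
    [/\ U t f0 a,
        {ae lebesgue_measure, forall tau, tau \in `]0, t[ ->
           U (t - tau) (fun x => (\1_omega x)%:C * u (tau, x)) (W tau)},
        is_bochner_integral mu `]0, t[%classic W b
      & L2 mu (f t) /\ {ae mu, forall x, f t x = a x + b x}].

(* L^2((0,T) x R^d) is the space of the u in L^2(R x R^d) vanishing outside
   (0,T) x R^d. *)
Definition exactly_controllable (T : R) : Prop :=
  forall f0 fT : X -> R[i], L2 mu f0 -> L2 mu fT ->
  exists (u : measurableTypeR R * X -> R[i]) (f : R -> X -> R[i]),
    [/\ L2 (lebesgue_measure \x mu)%E u,
        {ae (lebesgue_measure \x mu)%E,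
           forall p, ~ (`]0, T[%classic `*` omega) p -> u p = 0},
        is_mild_solution f0 u T f
      & {ae mu, forall x, f T x = fT x}].

End control.

Section density.
Variable R : realType.

Definition matrix_action d (A : 'M[R]_d) (x : euclidean R d) : euclidean R d :=
  [tuple \sum_(j < d) A i j * tnth x j | i < d].

Definition symmetric_box d (r : d.-tuple R) : set (euclidean R d) :=
  [set x | forall i, - tnth r i <= tnth x i <= tnth r i].

Definition box_density d (E : set (euclidean R d)) (r : d.-tuple R) : \bar R :=
  (lebesgue (E `&` symmetric_box r) / lebesgue (symmetric_box r))%E.

(* liminf_{r_1 -> +oo} ... liminf_{r_d -> +oo} F (r_1, ..., r_d), the innermost
   one being in r_d *)
Fixpoint iterated_liminf d : (d.-tuple R -> \bar R) -> \bar R :=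
  match d with
  | 0 => fun F => F [tuple]
  | d.+1 => fun F => limf_einf
      (fun r => iterated_liminf (fun v : d.-tuple R => F [tuple of r :: v]))
      (pinfty_nbhs R)
  end.

End density.

(* Main.v *)
(** Test the solution steering 0 to [fT] against a normalized eigenfunction phi
    of the harmonic oscillator. The propagator acts on phi by a unimodular
    factor, so for every delta > 0
      |<Re fT, phi>| <= delta / 2 * |u|^2 + T / delta * (integral of phi^2 on omega).
    If some orthonormal eigenfunctions phi_k had mass at most 16^-k on omega,
    then fT = sum_k 2^-k phi_k and delta = 4^-k would give 2^k <= |u|^2 / 2 + T
    for all k. Rotations preserve the eigenspaces, so for some c > 0 the
    functions Psi_a (A x) with all a_i large have mass at least c on omega.

    Given large r_1, ..., r_d, choose a_i slightly above r_i^2 / 2: then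
    psi_(a_i)^2 <= C / r_i on [-r_i, r_i], with little mass outside, so that
    c <= (2 C)^d * (density of A(omega) in the box) + c / 4. This bounds the
    density from below uniformly in all large boxes. *)

From HB Require Import structures.
From mathcomp Require Import all_boot all_order all_algebra ring.
From mathcomp Require mpoly ssrcomplements.

Set Implicit Arguments.
Unset Strict Implicit.
Unset Printing Implicit Defensive.

(** Exact controllability yields some control for each target, without a bound on its cost. The
    usual duality argument extracts a uniform cost from the closed graph theorem; here a single
    target assembled from all the bad eigenfunctions replaces it. The bases 2, 4, 16 are balanced so
    that the estimate reads 2^-k <= 4^-k |u|^2 / 2 + 4^k T 16^-k, where u is one fixed control: the
    right-hand side is O(4^-k). The mass bound is sought for every large [a] because the box
    dictates the indices. Its negation provides eigenfunctions of growing index, hence pairwise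
    orthogonal, and this is what lets them be superposed in one target. Boxes with sides parallel to
    the axes suit the tensor products Psi_a, so the rotation is moved from the set to the test
    function: the mass of Psi_a (A x) on omega is the mass of Psi_a on A(omega). The pointwise
    bounds must have the exact order 1 / r_i, since only then is their product a constant, (2 C)^d,
    divided by the volume of the box. *)

Module Rotation.
Import ssrcomplements mpoly.
Import GRing.Theory.
Local Open Scope ring_scope.

Lemma mnm_neq0_gt0 d (m : 'X_{1..d}) : m != 0%MM -> exists l, (0 < m l)%N.
Proof.
move=> m0; apply/existsP; apply: contraNT m0; rewrite negb_exists => /forallP m0.
by apply/eqP/mnmP => l; rewrite mnm0E; move: (m0 l); rewrite -leqNgt leqn0 => /eqP.
Qed.

(** * Products of Hermite polynomials under orthogonal changes of variables *)

Section hermite_rotation.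
Variables (R : comNzRingType) (h : nat -> R -> R).
Hypothesis h0 : forall x, h 0 x = 1.
(** For [n = 0] the truncated index [n.-1] is harmless, as its coefficient [n.*2] is zero. *)
Hypothesis hS : forall n x, h n.+1 x = x *+ 2 * h n x - n.*2%:R * h n.-1 x.
Variables (d : nat) (A : 'M[R]_d).
Hypothesis AAT : A *m A^T = 1%:M.

(* [Phi x] is the linear map sending 'X_[m] to [H m x]. It turns multiplication
   by 'X_i into the operator 2 x_i - 2 d/dX_i, which is equivariant under
   rotations: this makes [Phi x] commute with the substitution of [L] for 'X. *)
Let H (m : 'X_{1..d}) (x : 'I_d -> R) : R := \prod_i h (m i) (x i).
Let Phi x (p : {mpoly R[d]}) : R := \sum_(m <- msupp p) p@_m * H m x.

(** A common degree bound [k] lets polynomials with different supports be expanded over one index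
    type, where linearity is checked term by term. *)
Let PhiE x p k : (msize p <= k)%N ->
  Phi x p = \sum_(m : 'X_{1..d < k}) p@_m * H m x.
Proof.
move=> pk; rewrite /Phi (big_mksub ('X_{1..d < k} : subFinType _)) ?msupp_uniq //=.
  by rewrite big_rmcond //= => j /memN_msupp_eq0 ->; rewrite mul0r.
by move=> m /msize_mdeg_lt /leq_trans; apply.
Qed.

Let PhiB x : {morph Phi x : p q / p - q}.
Proof.
move=> p q; pose k := maxn (msize (p - q)) (maxn (msize p) (msize q)).
rewrite !(@PhiE _ _ k) ?leq_max ?leqnn ?orbT// -sumrB.
by apply: eq_bigr => m _; rewrite mcoeffB mulrBl.
Qed.

Let Phi0 x : Phi x 0 = 0. Proof. by rewrite -(subrr 0) PhiB subrr. Qed.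
Let PhiN x : {morph Phi x : p / - p}.
Proof. by move=> p; rewrite -[- p]sub0r PhiB Phi0 sub0r. Qed.
Let PhiD x : {morph Phi x : p q / p + q}.
Proof. by move=> p q; rewrite -[q in LHS]opprK PhiB PhiN opprK. Qed.

Let PhiZ x c p : Phi x (c *: p) = c * Phi x p.
Proof.
pose k := maxn (msize (c *: p)) (msize p).
rewrite !(@PhiE _ _ k) ?leq_max ?leqnn ?orbT// mulr_sumr.
by apply: eq_bigr => m _; rewrite mcoeffZ mulrA.
Qed.

Let PhiX x m : Phi x 'X_[m] = H m x.
Proof. by rewrite /Phi msuppX big_seq1 mcoeffX eqxx mul1r. Qed.

Let Phi_sum x (I : finType) (F : I -> {mpoly R[d]}) :
  Phi x (\sum_i F i) = \sum_i Phi x (F i).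
Proof. exact: (big_morph _ (PhiD x) (Phi0 x)). Qed.

Let HU m i x :
  H (m + U_(i))%MM x = x i *+ 2 * H m x - (m i).*2%:R * H (m - U_(i))%MM x.
Proof.
have HE (u : 'X_{1..d}) : (forall j, j != i -> u j = m j) ->
    H u x = h (u i) (x i) * \prod_(j | j != i) h (m j) (x j).
  move=> um; rewrite /H (bigD1 i)//=; congr (_ * _).
  by apply: eq_bigr => j /um ->.
rewrite !HE//; last first.
- by move=> j ji; rewrite mnmDE mnm1E eq_sym (negbTE ji) addn0.
- by move=> j ji; rewrite mnmBE mnm1E eq_sym (negbTE ji) subn0.
by rewrite mnmDE mnmBE mnm1E eqxx addn1 subn1 hS mulrBl !mulrA.
Qed.

Let Phi_mulX x i p :
  Phi x ('X_i * p) = x i *+ 2 * Phi x p - Phi x (p^`M(i)) *+ 2.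
Proof.
elim/mpolyind: p => [|c m p _ _ IH].
  by rewrite mulr0 mderiv0 !Phi0 mulr0 mul0rn subr0.
rewrite mulrDr mderivD !PhiD IH -scalerAr -mpolyXD addmC mderivZ !PhiZ PhiX.
rewrite mderivX PhiZ !PhiX HU.
move: (Phi x p) (Phi x _) => u v.
by rewrite -muln2; ring.
Qed.

Let L (i : 'I_d) : {mpoly R[d]} := \sum_j A i j *: 'X_j.
Let P (m : 'X_{1..d}) : {mpoly R[d]} := \prod_i L i ^+ m i.
(** The derivative along row [i] of [A]. As the rows are orthonormal, it plays the role of the
    partial derivative in the rotated variable [L i]. *)
Let D (i : 'I_d) (p : {mpoly R[d]}) := \sum_j A i j *: p^`M(j).

Let PU m i : P (m + U_(i))%MM = L i * P m.
Proof.
rewrite /P (bigD1 i)//= [in RHS](bigD1 i)//= mulrA -exprS.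
rewrite mnmDE mnm1E eqxx addn1; congr (_ * _); apply: eq_bigr => j ji.
by rewrite mnmDE mnm1E eq_sym (negbTE ji) addn0.
Qed.

Let DL i k : D i (L k) = (i == k)%:R.
Proof.
rewrite /D /L; under eq_bigr => j _.
  rewrite (raddf_sum (mderiv j)) /= (bigD1 j)//= big1 ?addr0; last first.
    move=> l lj; rewrite mderivZ mderivX mnm1E (negbTE lj) scale0r.
    by rewrite scaler0.
  rewrite mderivZ mderivX mnm1E eqxx scale1r -{1}[U_(j)%MM]add0m addmK mpolyX0 scalerA; over.
rewrite -scaler_suml -[LHS](_ : (A *m A^T) i k *: 1 = _); last first.
  by rewrite mxE; congr (_ *: _); apply: eq_bigr => j _; rewrite mxE.
by rewrite AAT mxE -mul_mpolyC mulr1 mpolyCMn mpolyC1.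
Qed.

Let DM i p q : D i (p * q) = D i p * q + p * D i q.
Proof.
rewrite /D mulr_suml mulr_sumr -big_split; apply: eq_bigr => j _ /=.
by rewrite mderivM scalerDr scalerAl scalerAr.
Qed.

(** [D i] is a derivation dual to the [L k], so it acts on their products as d/dX_i acts on
    monomials. The induction on the degree splits off one factor [L l]. *)
Let DP i m : D i (P m) = (m i)%:R * P (m - U_(i))%MM.
Proof.
have [k] := ubnP (mdeg m); elim: k m => // k IH m mk.
have [->|m0] := eqVneq m 0%MM.
  rewrite mnm0E mul0r /D big1// => j _.
  rewrite /P big1 => [|l _]; last by rewrite mnm0E expr0.
  by rewrite -[1]mpolyC1 mderivC scaler0.
have [l ml] := mnm_neq0_gt0 m0.
pose m' := (m - U_(l))%MM.
have mE : m = (m' + U_(l))%MM by rewrite submK// lep1mP -lt0n.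
have m'k : (mdeg m' < k)%N.
  by move: mk; rewrite mE mdegD mdeg1 addn1 ltnS.
rewrite [in LHS]mE PU DM DL IH// [in RHS]mE mnmDE mnm1E [l == i]eq_sym.
have [->|il] := eqVneq i l.
  rewrite mul1r addmK addn1 -natr1 mulrDl mul1r addrC; congr (_ + _).
  (* Truncated subtraction of [U_(l)] is a true inverse of adding it only if [m' l] is positive;
     otherwise the coefficient vanishes. *)
  have [->|m'l] := eqVneq (m' l) 0%N; first by rewrite !mul0r mulr0.
  rewrite mulrCA -PU submK// lep1mP; exact: m'l.
rewrite mul0r add0r addn0.
have [->|m'i] := eqVneq (m' i) 0%N; first by rewrite !mul0r mulr0.
rewrite mulrCA -PU; congr (_ * P _); apply/mnmP => j.
rewrite mnmDE [RHS]mnmBE mnmDE (mnmBE j m' U_(i)%MM) addnBAC// (mnm1E i).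
by case: eqVneq => // <-; rewrite lt0n.
Qed.

(** Both sides obey the same recurrence when a factor is added. On the left, multiplication by [L l]
    is the combination of [Phi_mulX] along row [l], whose derivative part is [D l], computed by
    [DP]; on the right it is [HU] at the rotated point. *)
Let Phi_P m x : Phi x (P m) = H m (fun i => \sum_j A i j * x j).
Proof.
have [k] := ubnP (mdeg m); elim: k m => // k IH m mk.
have [->|m0] := eqVneq m 0%MM.
  rewrite /P big1 => [|l _]; last by rewrite mnm0E expr0.
  rewrite -mpolyX0 PhiX /H.
  by rewrite !big1 // => l _; rewrite mnm0E h0.
have [l ml] := mnm_neq0_gt0 m0.
pose m' := (m - U_(l))%MM.
have mE : m = (m' + U_(l))%MM by rewrite submK// lep1mP -lt0n.
have m'k : (mdeg m' < k)%N.
  by move: mk; rewrite mE mdegD mdeg1 addn1 ltnS.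
rewrite mE PU HU {1}/L mulr_suml Phi_sum.
under eq_bigr do rewrite -scalerAl PhiZ Phi_mulX mulrBr.
rewrite sumrB; congr (_ - _).
  rewrite -IH// -sumrMnl mulr_suml; apply: eq_bigr => j _.
  by rewrite mulrA mulrnAr.
have -> : \sum_i A l i * (Phi x (P m')^`M(i) *+ 2) = Phi x (D l (P m')) *+ 2.
  rewrite /D Phi_sum -sumrMnl; apply: eq_bigr => j _.
  by rewrite PhiZ mulrnAr.
rewrite DP mulr_natl -scaler_nat PhiZ IH.
  by rewrite -mulrnAl -muln2 natrM mulr_natr.
by rewrite (leq_ltn_trans _ m'k)// mdegB.
Qed.

Let P_homog m : P m \is (mdeg m).-homog.
Proof.
rewrite /P mdegE; elim/big_ind2: _ => //.
- exact: dhomog1.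
- by move=> p k q l; exact: dhomogM.
- move=> i _; have L1 : L i \is 1.-homog.
    rewrite /L; apply: rpred_sum => j _; apply: rpredZ.
    by rewrite dhomogX/= mdeg1.
  by have := dhomogMn (m i) L1; rewrite mul1n.
Qed.

(** The coefficients are those of the polynomial [P m], to which [Phi x] is applied through [Phi_P]
    on one side and monomial by monomial on the other. Homogeneity of [P m] preserves the total
    degree, that is, the eigenvalue. *)
Lemma hermite_rotation (a : {ffun 'I_d -> nat}) :
  exists s : seq {ffun 'I_d -> nat}, exists c : {ffun 'I_d -> nat} -> R,
    (forall b, b \in s -> (\sum_i b i = \sum_i a i)%N) /\
    forall x, \prod_i h (a i) (\sum_j A i j * x j)
            = \sum_(b <- s) c b * \prod_i h (b i) (x i).
Proof.
pose m := [multinom a i | i < d].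
pose tof (m : 'X_{1..d}) : {ffun 'I_d -> nat} := [ffun i => m i].
pose ofm (b : {ffun 'I_d -> nat}) := [multinom b i | i < d].
have tofK : cancel tof ofm.
  by move=> u; apply/mnmP => i; rewrite mnmE ffunE.
exists (map tof (msupp (P m))), (fun b => (P m)@_(ofm b)); split.
- move=> _ /mapP[u uP ->]; have /dhomogP/(_ _ uP)/= := P_homog m.
  rewrite !mdegE => ua; under eq_bigr do rewrite ffunE.
  by rewrite ua; apply: eq_bigr => i _; rewrite mnmE.
- move=> x; transitivity (Phi x (P m)).
    by rewrite Phi_P; apply: eq_bigr => i _; rewrite mnmE.
  rewrite /Phi [RHS]big_map; apply: eq_bigr => u _; rewrite tofK; congr (_ * _).
  by apply: eq_bigr => i _; rewrite ffunE.
Qed.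

End hermite_rotation.
End Rotation.

Require Import Defs.
From mathcomp Require Import finmap complex lra zify.
From mathcomp Require Import all_classical all_reals all_analysis measurable_realfun.

Import Order.TTheory GRing.Theory Num.Theory.
Import numFieldNormedType.Exports.

Local Open Scope classical_set_scope.
Local Open Scope ring_scope.

(** * Hermite functions in dimension one *)

Section gaussian_polynomials.
Variable R : realType.
Implicit Types (p q : {poly R}) (x r : R).
Local Notation mu := (@lebesgue_measure R).

Lemma is_derive_horner_gauss p x :
  is_derive x 1 (fun y => p.[y] * gauss_fun y)
    ((p^`() - 'X *+ 2 * p).[x] * gauss_fun x).
Proof.
have gauss' : is_derive x 1 (@gauss_fun R) (gauss_fun x * - (x *+ 2)).
  apply: is_derive1_comp; apply: trigger_derive.
  by rewrite /GRing.scale/= !mulr1 mulr2n.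
apply: (@is_derive_eq _ _ _ (horner p * @gauss_fun R)).
rewrite /GRing.scale/= hornerD hornerN hornerM hornerMn hornerX.
by ring.
Qed.

(** Half of the exponent is sacrificed: with y = x^2 / 2, |x|^k <= 1 + x^(2k) and x^(2k) = 2^k y^k
    <= 2^k k! e^y. The other half is an unnormalized normal density, which is integrable. *)
Lemma normr_expn_gauss k x :
  `|x| ^+ k * gauss_fun x <= (1 + 2 ^+ k * k`!%:R) * normal_fun 0 1 x.
Proof.
have -> : gauss_fun x = normal_fun 0 1 x * normal_fun 0 1 x.
  rewrite /gauss_fun /normal_fun -expRD subr0 expr1n; congr expR; lra.
rewrite mulrA ler_wpM2r ?normal_fun_ge0//.
rewrite /normal_fun subr0 expr1n mulNr expRN ler_pdivrMr ?expR_gt0//.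
set y := x ^+ 2 / _; have y0 : 0 <= y by rewrite divr_ge0 ?sqr_ge0.
have -> : `|x| ^+ k <= 1 + x ^+ 2 ^+ k -> `|x| ^+ k <= (1 + 2 ^+ k * k`!%:R) * expR y.
  move=> /le_trans; apply; rewrite mulrDl mul1r lerD//.
    by rewrite -expR0 ler_expR.
  have -> : x ^+ 2 ^+ k = 2 ^+ k * y ^+ k.
    by rewrite -exprMn /y; congr (_ ^+ _); field.
  rewrite -mulrA ler_wpM2l ?exprn_ge0//.
  case: k => [|k]; first by rewrite expr0 mul1r -expR0 ler_expR.
  rewrite mulrC -ler_pdivrMr ?ltr0n ?fact_gt0//.
  by apply: le_trans (expR_ge1Dxn k y0); rewrite lerDr.
by [].
rewrite -(real_normK (num_real x)) -exprM mulnC exprM.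
have t0 : 0 <= `|x| ^+ k by rewrite exprn_ge0.
by move: (`|x| ^+ k) t0 => t t0; nra.
Qed.

Lemma horner_gauss_bound p :
  exists2 C, 0 <= C & forall x, `|p.[x] * gauss_fun x| <= C * normal_fun 0 1 x.
Proof.
exists (\sum_(i < size p) `|p`_i| * (1 + 2 ^+ i * i`!%:R)).
  by apply: sumr_ge0 => i _; rewrite mulr_ge0// addr_ge0// mulr_ge0// exprn_ge0.
move=> x; rewrite horner_coef mulr_suml mulr_suml.
apply: le_trans (ler_norm_sum _ _ _) _; apply: ler_sum => i _.
rewrite -!mulrA normrM ler_wpM2l// normrM (ger0_norm (gauss_fun_ge0 _)).
by rewrite normrX normr_expn_gauss.
Qed.

Lemma measurable_horner_gauss p :
  measurable_fun setT (fun x => p.[x] * gauss_fun x).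
Proof.
apply: measurable_funM; last exact: measurable_gauss_fun.
by apply: continuous_measurable_fun; exact: continuous_horner.
Qed.

Lemma integrable_horner_gauss p :
  mu.-integrable setT (fun x => (p.[x] * gauss_fun x)%:E).
Proof.
have [C C0 pC] := horner_gauss_bound p.
have s0 : (1 : R) != 0 by rewrite oner_eq0.
have := integrable_normal_pdf (0 : R) (1 : R).
move=> /(integrableZl measurableT (C / normal_peak 1)).
apply: le_integrable => //.
  by apply/measurable_EFinP; exact: measurable_horner_gauss.
move=> x _; rewrite lee_fin; apply: le_trans (pC x) _.
rewrite normal_pdfE// ger0_norm.
  by rewrite mulrA divfK// gt_eqF// normal_peak_gt0.
by rewrite !mulr_ge0 ?invr_ge0 ?normal_peak_ge0 ?normal_fun_ge0.
Qed.

Definition gauss_integral p := \int[mu]_x (p.[x] * gauss_fun x).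

Lemma gauss_integralE p :
  (\int[mu]_x (p.[x] * gauss_fun x)%:E)%E = (gauss_integral p)%:E.
Proof.
by rewrite fineK// integrable_fin_num//; exact: integrable_horner_gauss.
Qed.

Lemma gauss_integralD p q :
  gauss_integral (p + q) = gauss_integral p + gauss_integral q.
Proof.
rewrite /gauss_integral -RintegralD//; try exact: integrable_horner_gauss.
by apply: eq_Rintegral => x _; rewrite hornerD mulrDl.
Qed.

Lemma gauss_integralZ c p : gauss_integral (c *: p) = c * gauss_integral p.
Proof.
rewrite /gauss_integral -RintegralZl//; last exact: integrable_horner_gauss.
by apply: eq_Rintegral => x _; rewrite hornerZ mulrA.
Qed.

Lemma gauss_integralB p q :
  gauss_integral (p - q) = gauss_integral p - gauss_integral q.
Proof. by rewrite -scaleN1r gauss_integralD gauss_integralZ mulN1r. Qed.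

Lemma gauss_integral1 : gauss_integral 1 = Num.sqrt pi.
Proof.
rewrite /gauss_integral /Rintegral.
under eq_integral do rewrite hornerE mul1r.
by rewrite integralT_gauss.
Qed.

(** The two integrands differ by the derivative of p e^(-x^2). Its integral over [-n-1, n+1]
    consists of boundary terms that vanish in the limit, and dominated convergence recovers the
    integral over the line. *)
Lemma gauss_integral_deriv p : gauss_integral p^`() = gauss_integral ('X *+ 2 * p).
Proof.
apply/eqP; rewrite -subr_eq0 -gauss_integralB; apply/eqP.
set q := _ - _.
pose F (n : nat) := fun x => ((q.[x] * gauss_fun x) * \1_(`[- n.+1%:R, n.+1%:R]) x)%:E.
have FI n : (\int[mu]_x F n x)%E =
    (p.[n.+1%:R] * gauss_fun n.+1%:R - p.[- n.+1%:R] * gauss_fun (- n.+1%:R))%:E.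
  transitivity (\int[mu]_(x in `[(- n.+1%:R)%R, n.+1%:R%R]) (q.[x] * gauss_fun x)%:E)%E.
    rewrite [RHS]integral_mkcond; apply: eq_integral => x _.
    rewrite /F patchE indicE; case: ifPn => xn; first by rewrite mulr1.
    by rewrite mulr0.
  have cont (r : {poly R}) : continuous (fun y => r.[y] * gauss_fun y : R).
    move=> x; apply/differentiable_continuous/derivable1_diffP.
    by case: (is_derive_horner_gauss r x).
  rewrite (@continuous_FTC2 _ _ (fun x => p.[x] * gauss_fun x))//.
  - by rewrite gtrN.
  - exact: continuous_subspaceT.
  - split.
    + by move=> x _; case: (is_derive_horner_gauss p x).
    + exact/cvg_at_right_filter/cont.
    + exact/cvg_at_left_filter/cont.
  - move=> x _; rewrite derive1E; exact: (@derive_val _ _ _ _ _ _ _ (is_derive_horner_gauss p x)).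
have cv0 : (fun n => p.[n.+1%:R] * gauss_fun n.+1%:R
      - p.[- n.+1%:R] * gauss_fun (- n.+1%:R)) @ \oo --> (0 : R).
  (* Bounding x p(x) instead of p(x) gains a factor 1 / |x|, so that the boundary terms are O(1 /
     n). *)
  have [C C0 pC] := horner_gauss_bound ('X * p).
  have pN (x : R) (n : nat) : `|x| = n.+1%:R ->
      `|p.[x] * gauss_fun x| <= C * n.+1%:R^-1.
    move=> xn; rewrite -ler_pdivrMr ?invr_gt0// invrK mulrC -xn -normrM mulrA.
    have := pC x; rewrite hornerM hornerX => /le_trans; apply.
    rewrite ler_piMr// /normal_fun -expR0 ler_expR.
    by rewrite mulNr oppr_le0 divr_ge0 ?sqr_ge0.
  have cvC : (fun n => C * 2 * n.+1%:R^-1) @ \oo --> (0 : R).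
    rewrite -[X in _ --> X](mulr0 (C * 2)).
    by apply: cvgMr; exact: cvg_harmonic.
  apply: norm_cvg0; apply: squeeze_cvgr cvC; last exact: cvg_cst.
  apply: nearW => n; rewrite normr_ge0/= (le_trans (ler_normB _ _))//.
  by rewrite mulrAC mulrDr mulr1 lerD// pN// ?normrN ger0_norm.
have cvF : (fun n => \int[mu]_x F n x)%E @ \oo --> (gauss_integral q)%:E.
  rewrite -gauss_integralE.
  apply: (@dominated_cvg _ _ _ mu setT measurableT F _
    (fun x => `|(q.[x] * gauss_fun x)%:E|%E)).
  - move=> n; apply/measurable_EFinP/measurable_funM.
      exact: measurable_horner_gauss.
    exact: measurable_indic.
  - move=> x _; apply: cvg_near_cst.
    exists (Num.truncn `|x|) => // n /= xn.
    have {}xn : `|x : R| <= n.+1%:R.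
      by rewrite (le_trans (ltW (truncnS_gt _)))// ler_nat.
    by rewrite /F indicE mem_set ?mulr1//= in_itv/= -ler_norml.
  - by [].
  - by apply: integrable_abse; exact: integrable_horner_gauss.
  - move=> n x _; rewrite lee_fin [leLHS]normrM ler_piMr// indicE.
    by case: (_ \in _); rewrite ?normr1 ?normr0.
move: cvF; under eq_fun do rewrite FI.
by move=> /fine_cvgP[_] /= h; exact: (cvg_unique _ h cv0).
Qed.

(** This is the recursion behind the Rodrigues formula: the derivative of H_m e^(-x^2) is - H_(m+1)
    e^(-x^2). *)
Fixpoint hermite_poly n : {poly R} :=
  if n is m.+1 then 'X *+ 2 * hermite_poly m - (hermite_poly m)^`() else 1.

Lemma derive1n_gauss n :
  derive1n n (@gauss_fun R) =
  fun x => (-1) ^+ n * ((hermite_poly n).[x] * gauss_fun x).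
Proof.
elim: n => [|n IH]; first by apply/funext => x; rewrite expr0 mul1r hornerE mul1r.
rewrite derive1nS IH; apply/funext => x.
have h := is_derive_horner_gauss (hermite_poly n) x.
rewrite derive1E; transitivity ((-1) ^+ n *:
    (((hermite_poly n)^`() - 'X *+ 2 * hermite_poly n).[x] * gauss_fun x)).
  exact: (@derive_val _ _ _ _ _ _ _ (is_deriveZ _ h)).
rewrite /GRing.scale/= exprS !hornerD !hornerN.
by ring.
Qed.

Lemma hermite_polynomialE n x : hermite_polynomial n x = (hermite_poly n).[x].
Proof.
rewrite /hermite_polynomial (derive1n_gauss n) mulrAC mulrA -exprD addnn.
rewrite -muln2 mulnC exprM sqrrN !expr1n mul1r -mulrA.
by rewrite /gauss_fun -expRD addNr expR0 mulr1.
Qed.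

Lemma deriv_hermite_poly n :
  (hermite_poly n)^`() = n.*2%:R *: hermite_poly n.-1.
Proof.
elim: n => [|n IH]; first by rewrite -[hermite_poly 0]/(1%:P) derivC scale0r.
rewrite /= derivB derivM derivMn derivX.
have -> : (hermite_poly n)^`()^`() = 'X *+ 2 * (hermite_poly n)^`() - n.*2%:R *: hermite_poly n.
  case: n IH => [_|n ->].
    by rewrite -[hermite_poly 0]/(1%:P) derivC deriv0 mulr0 scale0r subr0.
  rewrite [hermite_poly n.+1]/= derivZ -scalerAr -scalerBr; congr (_ *: _).
  by rewrite opprB addrC subrK.
rewrite opprB [X in _ + X]addrC -addrA addNKr doubleS mulr_natl -scaler_nat.
by rewrite -scalerDl -natrD.
Qed.

Lemma hermite_polyS n x : (hermite_poly n.+1).[x] =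
  x *+ 2 * (hermite_poly n).[x] - n.*2%:R * (hermite_poly n.-1).[x].
Proof.
by rewrite [hermite_poly _]/= deriv_hermite_poly hornerD hornerN hornerM hornerMn hornerX hornerZ.
Qed.

(** For the Gaussian weight, the raising operator 2x - d/dx is the adjoint of d/dx. *)
Lemma gauss_integral_hermiteS n p :
  gauss_integral (hermite_poly n.+1 * p) = gauss_integral (hermite_poly n * p^`()).
Proof.
apply/eqP; rewrite -subr_eq0 -gauss_integralB /= mulrBl -mulrA.
rewrite -addrA -opprD -derivM gauss_integralB.
by rewrite gauss_integral_deriv subrr.
Qed.

Lemma gauss_integral_hermiteM n m : gauss_integral (hermite_poly n * hermite_poly m) =
  (n == m)%:R * (Num.sqrt pi * 2 ^+ n * n`!%:R).
Proof.
elim: n m => [|n IH] [|m].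
- by rewrite mulr1 gauss_integral1 mul1r expr0 fact0 !mulr1.
- by rewrite mulrC gauss_integral_hermiteS -[hermite_poly 0]/(1%:P) derivC mulr0 -(scale0r 0) gauss_integralZ !mul0r.
- by rewrite gauss_integral_hermiteS -[hermite_poly 0]/(1%:P) derivC mulr0 -(scale0r 0) gauss_integralZ !mul0r.
rewrite gauss_integral_hermiteS deriv_hermite_poly -scalerAr gauss_integralZ IH/= eqSS.
have [->|] := eqVneq n m; last by rewrite !mul0r mulr0.
by rewrite !mul1r factS natrM exprS -muln2 natrM; ring.
Qed.

Definition hermite_const n : R :=
  pi `^ (- 4^-1) * 2 `^ (- (n%:R / 2)) * n`!%:R `^ (- 2^-1).

Lemma hermite_const_gt0 n : 0 < hermite_const n.
Proof. by rewrite !mulr_gt0// powR_gt0// ?pi_gt0// ltr0n fact_gt0. Qed.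

Lemma hermite_const_sqr n :
  hermite_const n ^+ 2 = (Num.sqrt pi * 2 ^+ n * n`!%:R)^-1.
Proof.
rewrite /hermite_const !exprMn -!powR_mulrn ?powR_ge0// -!powRrM.
rewrite -powR12_sqrt ?pi_ge0// -!mulNr !mulfVK// !invfM -!powRN -(powR_inv1 (ler0n _ n`!)).
by congr (_ `^ _ * _ * _ `^ _); lra.
Qed.

Lemma hermite_constS n :
  hermite_const n = Num.sqrt n.+1.*2%:R * hermite_const n.+1.
Proof.
apply/eqP; rewrite -(@eqrXn2 _ 2)//; first last.
- by rewrite mulr_ge0 ?sqrtr_ge0// ltW// hermite_const_gt0.
- by rewrite ltW// hermite_const_gt0.
rewrite (exprMn _ (Num.sqrt _)) sqr_sqrtr// !hermite_const_sqr; apply/eqP.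
rewrite factS natrM exprS -muln2 natrM; field.
by rewrite pnatr_eq0 -lt0n fact_gt0 nat1r pnatr_eq0 expf_neq0//= gt_eqF ?sqrtr_gt0 ?pi_gt0.
Qed.

(* Locked so that unification does not unfold the Hermite recursion. *)
Definition normalized_hermite n : {poly R} :=
  locked (hermite_const n *: hermite_poly n).
Local Notation hp := normalized_hermite.

Lemma normalized_hermiteE n : hp n = hermite_const n *: hermite_poly n.
Proof. by rewrite /normalized_hermite -lock. Qed.

Lemma normalized_hermite0 : hp 0 = (hermite_const 0)%:P.
Proof. by rewrite normalized_hermiteE/= -[1]/(1%:P) -mul_polyC -polyCM mulr1. Qed.

Lemma hermite_functionE n x :
  hermite_function n x = (hp n).[x] * expR (- (x ^+ 2 / 2)).
Proof.
by rewrite /hermite_function hermite_polynomialE normalized_hermiteE hornerZ mulrAC.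
Qed.

Lemma hermite_function_sqr n x :
  hermite_function n x ^+ 2 = (hp n ^+ 2).[x] * gauss_fun x.
Proof.
rewrite hermite_functionE exprMn -horner_exp -expRM_natl.
by rewrite /gauss_fun; congr (_ * expR _); field.
Qed.

Lemma hermite_functionM m n x :
  hermite_function m x * hermite_function n x = (hp m * hp n).[x] * gauss_fun x.
Proof.
rewrite !hermite_functionE hornerM mulrACA -expRD.
by rewrite /gauss_fun; congr (_ * expR _); field.
Qed.

Lemma deriv_normalized_hermite n :
  (hp n)^`() = Num.sqrt n.*2%:R *: hp n.-1.
Proof.
rewrite !normalized_hermiteE derivZ deriv_hermite_poly !scalerA.
case: n => [|n]; first by rewrite sqrtr0 mul0r mulr0.
rewrite [hermite_const n]hermite_constS mulrA -expr2 sqr_sqrtr//.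
by rewrite mulrC.
Qed.

Lemma normalized_hermiteS n :
  Num.sqrt n.+1.*2%:R *: hp n.+1 = 'X *+ 2 * hp n - (hp n)^`().
Proof.
rewrite !normalized_hermiteE derivZ -scalerAr -scalerBr -[_ - _]/(hermite_poly n.+1).
by rewrite scalerA -hermite_constS.
Qed.

Lemma sqrt_double n : Num.sqrt n.*2%:R = 2 * Num.sqrt (n%:R / 2) :> R.
Proof.
rewrite -[X in X * Num.sqrt _](@ger0_norm R)// -sqrtr_sqr -sqrtrM ?sqr_ge0//.
by congr Num.sqrt; rewrite -muln2 natrM; field.
Qed.

(** Half the sum of the raising and lowering relations. Multiplication by x thus is a Jacobi matrix
    in the Hermite basis, from which the moments are computed. *)
Lemma mulX_normalized_hermite n : 'X * hp n =
  Num.sqrt (n.+1%:R / 2) *: hp n.+1 + Num.sqrt (n%:R / 2) *: hp n.-1.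
Proof.
have two : (2 : R) != 0 by [].
apply: (scalerI two); rewrite scalerDr (scalerA 2) (scalerA 2) -!sqrt_double.
rewrite normalized_hermiteS -deriv_normalized_hermite subrK.
by rewrite scaler_nat mulrnAl.
Qed.

Lemma gauss_integral_normalized m n : gauss_integral (hp m * hp n) = (m == n)%:R.
Proof.
rewrite !normalized_hermiteE -scalerAl -scalerAr !gauss_integralZ gauss_integral_hermiteM.
have [->|] := eqVneq; last by rewrite mul0r !mulr0.
rewrite mulrA -expr2 hermite_const_sqr mul1r mulVf// gt_eqF//.
by rewrite !mulr_gt0 ?exprn_gt0 ?sqrtr_gt0 ?pi_gt0// ltr0n fact_gt0.
Qed.

(** * Moments, tails and pointwise bounds of Hermite functions *)

Definition hermite_moment k m n := gauss_integral ('X^k * (hp m * hp n)).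

Lemma hermite_momentS k m n : hermite_moment k.+1 m n =
  Num.sqrt (m.+1%:R / 2) * hermite_moment k m.+1 n
  + Num.sqrt (m%:R / 2) * hermite_moment k m.-1 n.
Proof.
rewrite /hermite_moment -!gauss_integralZ -gauss_integralD; congr gauss_integral.
rewrite exprSr -mulrA ['X * _]mulrA mulX_normalized_hermite mulrDl mulrDr.
by rewrite -!scalerAl -!scalerAr.
Qed.

Lemma hermite_moment_eq0 k m n : (m + k < n)%N -> hermite_moment k m n = 0.
Proof.
elim: k m => [|k IH] m mn.
  rewrite /hermite_moment mul1r gauss_integral_normalized.
  by case: eqVneq mn => // ->; rewrite addn0 ltnn.
rewrite hermite_momentS !IH ?mulr0 ?addr0//; last by rewrite addSnnS.
by rewrite (leq_ltn_trans _ mn)// leq_add// leq_pred.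
Qed.

(* Each factor x moves the index of psi_m one step up or down, so the moment is
   a sum over lattice paths with j down-steps. *)
Lemma hermite_moment_le N k m n j : (m + k <= N)%N -> (m + k = n + j.*2)%N ->
  `|hermite_moment k m n| <= Num.sqrt (N%:R / 2) ^+ k * 'C(k, j)%:R.
Proof.
have sq l : (l <= N)%N -> Num.sqrt (l%:R / 2) <= Num.sqrt (N%:R / 2) :> R.
  by move=> lN; rewrite ler_wsqrtr// ler_pM2r ?invr_gt0// ler_nat.
elim: k m j => [|k IH] m j mN mE.
  rewrite /hermite_moment mul1r gauss_integral_normalized expr0 mul1r.
  case: j mE => [|j] mE; first by rewrite bin0; case: eqP; rewrite ?normr1 ?normr0.
  by case: eqP mE => [->|_ _]; [lia|rewrite normr0].
rewrite hermite_momentS (le_trans (ler_normD _ _))// !normrM.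
rewrite !(ger0_norm (sqrtr_ge0 _)).
have up : Num.sqrt (m.+1%:R / 2) * `|hermite_moment k m.+1 n|
    <= Num.sqrt (N%:R / 2) ^+ k.+1 * 'C(k, j)%:R.
  rewrite exprS -mulrA ler_pM ?sqrtr_ge0//; first by apply: sq; lia.
  by apply: IH; lia.
(* With no down-step to spend, [n] is out of reach from [m.-1] in [k] steps and the second term
   vanishes. Otherwise Pascal's rule adds the two families of paths. *)
case: j mE up => [|j] mE up.
  rewrite (@hermite_moment_eq0 k m.-1); last by lia.
  by rewrite normr0 mulr0 addr0; rewrite bin0 in up *.
rewrite binS natrD mulrDr lerD//.
case: m mE mN {up} => [|m] mE mN.
  by rewrite mul0r sqrtr0 mul0r !mulr_ge0// exprn_ge0// sqrtr_ge0.
rewrite exprS -mulrA ler_pM ?sqrtr_ge0//; first by apply: sq; lia.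
by apply: IH; lia.
Qed.

(** Markov's inequality for the 2k-th moment of the probability density psi_n^2. *)
Lemma hermite_tail n k r : 0 < r ->
  (\int[mu]_(x in [set x | (r < `|x|)%R]) (hermite_function n x ^+ 2)%:E
   <= (hermite_moment k.*2 n n / r ^+ k.*2)%:E)%E.
Proof.
move=> r0; rewrite integral_mkcond /hermite_moment mulrC -gauss_integralZ.
rewrite -gauss_integralE.
have sq2 x y : x ^+ k.*2 * y ^+ 2 = (x ^+ k * y) ^+ 2.
  by rewrite exprMn -exprM muln2.
have gE x : ((r ^+ k.*2)^-1 *: ('X^(k.*2) * (hp n * hp n))).[x] * gauss_fun x
    = (r ^- k * x ^+ k * hermite_function n x) ^+ 2.
  rewrite hornerZ hornerM hornerXn exprMn hermite_function_sqr -expr2.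
  by rewrite exprMn -!exprVn -!exprM !muln2 !mulrA.
have mh : measurable_fun setT (fun x => hermite_function n x ^+ 2).
  under eq_fun do rewrite hermite_function_sqr.
  exact: measurable_horner_gauss.
apply: ge0_le_integral => //.
- by move=> x _; rewrite patchE; case: ifP => // _; rewrite lee_fin sqr_ge0.
- apply/(measurable_restrictT _ _).1; last exact/measurable_EFinP/measurable_funTS.
  have -> : [set x | r < `|x|] = ~` `[- r, r] :> set R.
    by apply/seteqP; split => x /=; rewrite in_itv/= -ler_norml ltNge => /negP.
  exact: measurableC.
- by apply/measurable_EFinP; exact: measurable_horner_gauss.
- move=> x _; rewrite patchE; case: ifPn => xr; rewrite lee_fin gE ?sqr_ge0//.
  move: xr; rewrite inE/= => xr.
  rewrite [leRHS]exprMn ler_peMl ?sqr_ge0// -exprVn -exprMn -exprM.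
  rewrite mulnC exprM -(real_normK (num_real _)) -exprM exprn_ege1//.
  by rewrite normrM normfV (gtr0_norm r0) ler_pdivlMl// mulr1 ltW.
Qed.

(** The left side decreases in [k]: its successive ratios are (2k + 1) (2k + 3) / (2k + 2)^2 <= 1.
    The resulting decay like k^(-1/2) is what makes the mass outside the box small. *)
Lemma central_binomial_bound k : ('C(k.*2, k)%:R / 4 ^+ k) ^+ 2 * k.*2.+1%:R <= 1 :> R.
Proof.
elim: k => [|k IH]; first by rewrite bin0 expr0 divr1 expr1n mul1r.
have kE : 'C(k.+1.*2, k.+1)%:R = 'C(k.*2, k)%:R * (2 * k.*2.+1%:R / k.+1%:R) :> R.
  have : ('C(k.+1.*2, k.+1) * k.+1 = 2 * k.*2.+1 * 'C(k.*2, k))%N.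
    have h1 := mul_bin_diag k.*2.+2 k; have h2 := mul_bin_diag k.*2.+1 k.
    have h3 : 'C(k.*2.+1, k.+1) = 'C(k.*2.+1, k).
      rewrite -bin_sub; last by rewrite ltnS -addnn leq_addr.
      by congr 'C(_, _); rewrite subSS -addnn addnK.
    by rewrite doubleS; rewrite /= in h1 h2; nia.
  move=> /(congr1 (fun n => n%:R : R)); rewrite !natrM => h.
  by rewrite mulrCA mulrA [X in _ = X](_ : _ = 2 * k.*2.+1%:R * 'C(k.*2, k)%:R / k.+1%:R); [rewrite -h mulfK|ring].
rewrite kE (exprSr 4 k) invfM mulrACA exprMn -mulrA; apply: le_trans IH.
rewrite -mulrA ler_wpM2l ?sqr_ge0//.
have k0 : (0 : R) <= k%:R by [].
have -> : k.*2.+1%:R = k%:R * 2 + 1 :> R by rewrite -addn1 -muln2 natrD natrM.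
have -> : k.+1.*2.+1%:R = k%:R * 2 + 3 :> R.
  by rewrite doubleS -addn3 -muln2 natrD natrM.
have -> : k.+1%:R = k%:R + 1 :> R by rewrite natr1.
move: k%:R k0 => t t0.
rewrite (_ : _ * _ = (t * 2 + 1) ^+ 2 * (t * 2 + 3) / (4 * (t + 1) ^+ 2)); last first.
  by field; lra.
rewrite ler_pdivrMr; last by nra.
nra.
Qed.

(* E = 2 sum_(k < n) psi_k^2 + psi_n^2 satisfies E' = - 2 x psi_n^2, hence is
   maximal at 0; it dominates (2 n + 1 - x^2) psi_n^2. *)
Definition hermite_energy n : {poly R} := \sum_(k < n) hp k ^+ 2 *+ 2 + hp n ^+ 2.

Lemma hermite_energyS n :
  hermite_energy n.+1 = hermite_energy n + (hp n ^+ 2 + hp n.+1 ^+ 2).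
Proof. by rewrite /hermite_energy big_ord_recr/= mulr2n !addrA. Qed.

Lemma deriv_hermite_energy n :
  (hermite_energy n)^`() - 'X *+ 2 * hermite_energy n = - ('X *+ 2 * hp n ^+ 2).
Proof.
elim: n => [|n IH].
  rewrite /hermite_energy big_ord0 add0r normalized_hermite0.
  by rewrite expr2 -polyCM derivC sub0r.
rewrite hermite_energyS derivD mulrDr opprD addrACA IH derivD !derivM.
rewrite (deriv_normalized_hermite n.+1) [n.+1.-1]/=.
have := normalized_hermiteS n; move: (hp n) (hp n.+1) (_)^`() => p q p' E.
rewrite expr2 (mulrC (_ *: p)) -!scalerAr scalerAl E.
by ring.
Qed.

(** Since psi_n' = (p' - x p) e^(-x^2 / 2) with p the polynomial factor of psi_n, this is, up to the
    Gaussian weight, the Sonin function (2n + 1 - x^2) psi_n^2 + psi_n'^2 of the equation psi'' +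
    (2n + 1 - x^2) psi = 0. *)
Lemma hermite_energyE n x : (hermite_energy n).[x] =
  (n.*2.+1%:R - x ^+ 2) * (hp n).[x] ^+ 2 + ((hp n)^`().[x] - x * (hp n).[x]) ^+ 2.
Proof.
elim: n => [|n IH].
  rewrite /hermite_energy big_ord0 add0r normalized_hermite0.
  by rewrite derivC horner_exp !hornerC double0; ring.
rewrite hermite_energyS (hornerD (hermite_energy n)) IH hornerD !horner_exp.
rewrite (deriv_normalized_hermite n.+1) [n.+1.-1]/=.
have := congr1 (horner^~ x) (normalized_hermiteS n).
rewrite /= hornerD hornerN hornerM hornerMn hornerX !hornerZ.
have : Num.sqrt n.+1.*2%:R ^+ 2 = n.*2%:R + 2 :> R.
  by rewrite sqr_sqrtr// doubleS -addn2 natrD.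
have -> : n.+1.*2.+1%:R = n.*2%:R + 3 :> R by rewrite doubleS -addn3 natrD.
have -> : n.*2.+1%:R = n.*2%:R + 1 :> R by rewrite natr1.
move: (Num.sqrt _) n.*2%:R (_.[x]) (_.[x]) ((_)^`().[x]).
move=> s m p q p' s2 E.
have -> : p' = x *+ 2 * p - s * q by rewrite E; ring.
have -> : m = s ^+ 2 - 2 by rewrite s2; ring.
ring.
Qed.

(** At 0 the relation for x psi_m links the values of index m - 1 and m + 1. Along such steps of two
    the quantity is multiplied by (n + 1) (n + 3) / (n + 2)^2 <= 1, and it starts from 1 / pi or
    0. *)
Lemma normalized_hermite_at0 n : n.+1%:R * (hp n).[0] ^+ 4 <= 1.
Proof.
have rec m : m.+1%:R * (hp m.+1).[0] ^+ 2 = m%:R * (hp m.-1).[0] ^+ 2.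
  have := congr1 (horner^~ 0) (mulX_normalized_hermite m).
  rewrite /= hornerM hornerX mul0r hornerD !hornerZ => /esym/eqP.
  rewrite addr_eq0 => /eqP/(congr1 (fun y => y ^+ 2)).
  rewrite sqrrN !(exprMn _ (Num.sqrt _)) !sqr_sqrtr ?divr_ge0// => h.
  by move: h; lra.
have [m] := ubnP n; elim: m n => // m IH [_|[_|n]].
- rewrite mul1r normalized_hermite0 hornerC (exprM _ 2 2) hermite_const_sqr.
  rewrite expr0 fact0 !mulr1 exprVn sqr_sqrtr ?pi_ge0//.
  by rewrite invf_le1 ?pi_gt0// (le_trans _ (pi_ge2 _))// ler1n.
- have := rec 0%N; rewrite mul0r mul1r => /eqP; rewrite sqrf_eq0 => /eqP ->.
  by rewrite expr0n mulr0.
rewrite ltnS => nm; have {IH} := IH n (ltnW nm).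
have := rec n.+1; rewrite [n.+1.-1]/=.
rewrite !(exprM _ 2 2); move: ((hp n.+2).[0] ^+ 2) ((hp n).[0] ^+ 2) => a b.
rewrite -!natr1; move: n%:R (ler0n R n) => t t0 E h.
have -> : a = (t + 1) / (t + 1 + 1) * b.
  by rewrite mulrAC -E [RHS]mulrC mulKf//; apply/eqP; lra.
have t2 : 0 < t + 1 + 1 by lra.
rewrite exprMn mulrA; apply: le_trans h.
rewrite ler_wpM2r ?sqr_ge0//.
rewrite exprMn exprVn mulrA ler_pdivrMr; last by nra.
by nra.
Qed.

Lemma hermite_energy_at0 n : (hermite_energy n).[0] <= 4 * Num.sqrt n.+1%:R.
Proof.
have bnd m : m.+1%:R * (hp m).[0] ^+ 2 <= Num.sqrt m.+1%:R.
  have a0 : 0 <= m.+1%:R * (hp m).[0] ^+ 2 by rewrite mulr_ge0// sqr_ge0.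
  rewrite -(ger0_norm a0) -sqrtr_sqr ler_wsqrtr//.
  rewrite exprMn -exprM expr2 -mulrA ler_piMr//.
  exact: normalized_hermite_at0.
rewrite hermite_energyE expr0n subr0 mul0r subr0 deriv_normalized_hermite.
rewrite hornerZ exprMn sqr_sqrtr//.
have h1 : n.*2.+1%:R * (hp n).[0] ^+ 2 <= 2 * Num.sqrt n.+1%:R.
  apply: le_trans (_ : 2 * (n.+1%:R * (hp n).[0] ^+ 2) <= _).
    by rewrite mulrA ler_wpM2r ?sqr_ge0// -natrM ler_nat; lia.
  by rewrite ler_wpM2l.
have h2 : n.*2%:R * (hp n.-1).[0] ^+ 2 <= 2 * Num.sqrt n.+1%:R.
  case: n {h1} => [|n]; first by rewrite mul0r mulr_ge0.
  rewrite -muln2 natrM mulrAC mulrC ler_wpM2l// (le_trans (bnd n))//.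
  by rewrite ler_wsqrtr// ler_nat.
by move: h1 h2; lra.
Qed.

Lemma hermite_energy_max n x :
  (hermite_energy n).[x] * gauss_fun x <= (hermite_energy n).[0].
Proof.
pose F (y : R) : R := (hermite_energy n).[y] * gauss_fun y.
pose F' (y : R) : R := - (y *+ 2 * (hp n).[y] ^+ 2) * gauss_fun y.
have dF (y : R) : is_derive y (1 : R) F (F' y).
  have := is_derive_horner_gauss (hermite_energy n) y.
  by rewrite deriv_hermite_energy hornerN hornerM hornerMn hornerX horner_exp.
have cF : continuous F.
  by move=> y; apply/differentiable_continuous/derivable1_diffP; case: (dF y).
have F0 : F 0 = (hermite_energy n).[0].
  by rewrite /F /gauss_fun expr0n oppr0 expR0 mulr1.
rewrite -F0 -/(F x) -subr_ge0.
have [x0|x0] := leP 0 x.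
  have [c] := @MVT_segment _ F F' 0 x x0 (fun y _ => dF y) (continuous_subspaceT cF).
  rewrite in_itv/= => /andP[c0 _] E; rewrite -opprB E subr0 oppr_ge0.
  rewrite /F' !mulNr oppr_le0 mulr_ge0// mulr_ge0 ?gauss_fun_ge0//.
  by rewrite mulr_ge0 ?sqr_ge0// mulrn_wge0.
have [c] := @MVT_segment _ F F' x 0 (ltW x0) (fun y _ => dF y) (continuous_subspaceT cF).
rewrite in_itv/= => /andP[_ c0] ->; rewrite sub0r /F' -mulNr -mulNrn.
apply: mulr_ge0; last by rewrite oppr_ge0 ltW.
rewrite mulr_ge0 ?gauss_fun_ge0//.
by rewrite mulr_ge0 ?sqr_ge0// mulrn_wge0 ?oppr_ge0.
Qed.

Lemma hermite_function_bound n x :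
  (n.*2.+1%:R - x ^+ 2) * hermite_function n x ^+ 2 <= 4 * Num.sqrt n.+1%:R.
Proof.
apply: le_trans (hermite_energy_at0 n).
apply: le_trans (hermite_energy_max n x).
rewrite hermite_function_sqr mulrA ler_wpM2r ?gauss_fun_ge0//.
by rewrite hermite_energyE horner_exp lerDl sqr_ge0.
Qed.

(* With k large and 2n ~ (1 + 1/k) r^2, the turning points of psi_n lie just
   outside [-r, r], and the 2k-th moment shows that little mass escapes. *)
Lemma hermite_concentration (eta : R) : 0 < eta -> exists2 C, 0 < C &
  forall N0 : nat, exists r0, forall r, r0 <= r -> exists n, [/\ (N0 <= n)%N,
    0 < r, forall x, `|x| <= r -> hermite_function n x ^+ 2 <= C / r &
    (\int[mu]_(x in [set x | (r < `|x|)%R]) (hermite_function n x ^+ 2)%:E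
      <= eta%:E)%E].
Proof.
move=> eta0; have e2 : 0 < expR 2 :> R by exact: expR_gt0.
(* The tail will be at most e^2 (2k + 1)^(-1/2), so [k] is taken of size (e^2 / eta)^2. *)
pose k := (Num.truncn ((expR 2 / eta) ^+ 2)).+1.
have kE : expR 2 ^+ 2 <= eta ^+ 2 * k%:R.
  rewrite -ler_pdivrMl ?exprn_gt0// mulrC -expr_div_n ltW//.
  exact: truncnS_gt.
have k0 : (0 : R) < k%:R by rewrite ltr0n.
have k1 : (1 : R) <= k%:R by rewrite ler1n.
(* The gap 2n + 1 - x^2 will be at least r^2 / (2k), and 4 sqrt(n + 1) at most 8 r; the quotient is
   16 k / r. *)
exists (16 * k%:R); first by rewrite mulr_gt0.
(* This threshold secures r^2 / k >= 2 for the gap, r^2 / 2 >= [N0] for the index, and 4k / r^2 <= 1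
   / k for the tail. *)
move=> N0; exists (4 * k%:R ^+ 2 + 2 * N0%:R + 2) => r rr.
have N00 : (0 : R) <= N0%:R by [].
have r1 : 1 <= r by nra.
have r2 : r <= r ^+ 2 by nra.
have r0 : 0 < r by lra.
have ki0 : 0 < k%:R^-1 :> R by rewrite invr_gt0.
have kk : k%:R * k%:R^-1 = 1 :> R by rewrite mulfV// gt_eqF.
have ki1 : k%:R^-1 <= 1 :> R by rewrite invf_le1.
pose q := (1 + k%:R^-1) * r ^+ 2 / 2.
have q0 : 0 <= q by rewrite !mulr_ge0// ?addr_ge0// ltW.
pose n := Num.truncn q.
have nq : n%:R <= q by case/andP: (truncn_itv q0).
have qn : q < n%:R + 1 by rewrite natr1 truncnS_gt.
have N0n : (N0 <= n)%N.
  rewrite -ltnS -(ltr_nat R) -natr1; apply: le_lt_trans qn.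
  by rewrite /q; nra.
exists n; split => //.
  move=> x xr.
  have x2 : x ^+ 2 <= r ^+ 2 by rewrite -real_normK ?num_real// ler_pXn2r// nnegrE ltW.
  have h1 : r ^+ 2 * (k%:R^-1 / 2) <= n.*2.+1%:R - x ^+ 2.
    have -> : n.*2.+1%:R = 2 * n%:R + 1 :> R by rewrite -natr1 -muln2 natrM mulrC.
    have : 2 <= r ^+ 2 * k%:R^-1.
      by rewrite ler_pdivlMr//; nra.
    by rewrite /q in qn *; nra.
  have h2 : Num.sqrt n.+1%:R <= 2 * r.
    have r20 : 0 <= 2 * r by lra.
    rewrite -(ger0_norm r20) -sqrtr_sqr ler_wsqrtr// -natr1.
    by move: nq; rewrite /q; nra.
  have := hermite_function_bound n x.
  move: (hermite_function n x ^+ 2) (sqr_ge0 (hermite_function n x)) => y y0 h3.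
  rewrite ler_pdivlMr//.
  have h4 : r ^+ 2 * (k%:R^-1 / 2) * y <= 8 * r.
    apply: le_trans (_ : 4 * (2 * r) <= _); last by lra.
    apply: le_trans (_ : 4 * Num.sqrt n.+1%:R <= _); last by rewrite ler_wpM2l.
    by apply: le_trans h3; rewrite ler_wpM2r.
  have h5 : r * (y * r) <= r * (16 * k%:R).
    have : k%:R * (r ^+ 2 * (k%:R^-1 / 2) * y) <= k%:R * (8 * r) by rewrite ler_pM2l.
    have -> : k%:R * (r ^+ 2 * (k%:R^-1 / 2) * y) = (k%:R * k%:R^-1) * (r ^+ 2 / 2 * y) by ring.
    by rewrite kk; lra.
  by rewrite ler_pM2l in h5.
apply: le_trans (hermite_tail n k r0) _; rewrite lee_fin.
have h : hermite_moment k.*2 n n <= ((n + k.*2)%:R / 2) ^+ k * 'C(k.*2, k)%:R.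
  have := @hermite_moment_le (n + k.*2) k.*2 n n k (leqnn _) erefl.
  move=> /(le_trans (ler_norm _)); rewrite -mul2n exprM sqr_sqrtr//.
have -> : eta = expR 2 * (eta / expR 2) by rewrite mulrCA divff ?mulr1// gt_eqF.
(* The first factor is at most (1 + 2 / k)^k <= e^2, because 2n <= (1 + 1 / k) r^2 and 4k <= r^2 /
   k. The second is at most eta / e^2 by the choice of [k]. *)
apply: le_trans (_ : ((2 * (n + k.*2)%:R) / r ^+ 2) ^+ k * ('C(k.*2, k)%:R / 4 ^+ k) <= _).
  rewrite ler_pdivrMr ?exprn_gt0//; apply: le_trans h _.
  rewrite -mul2n exprM (expr_div_n (2 * _)).
  have -> : 2 * (n + 2 * k)%:R = 4 * ((n + 2 * k)%:R / 2) :> R by field.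
  have f0 : (4 : R) ^+ k != 0 by rewrite expf_neq0.
  have rk0 : r ^+ 2 ^+ k != 0 by rewrite !expf_neq0// gt_eqF.
  rewrite (exprMn k 4) le_eqVlt; apply/orP; left; apply/eqP.
  move: (_ ^+ k) (4 ^+ k) f0 (r ^+ 2 ^+ k) rk0 'C(_, _)%:R => u w w0 v v0 c.
  by field; rewrite w0.
rewrite ler_pM//.
- by rewrite exprn_ge0// divr_ge0 ?sqr_ge0// mulr_ge0.
- have -> : (2 : R) = 2 / k%:R * k%:R by rewrite divfK// gt_eqF.
  rewrite expRM_natr lerXn2r ?nnegrE ?expR_ge0//.
    by rewrite divr_ge0 ?sqr_ge0// mulr_ge0// divfK// gt_eqF.
  apply: le_trans (expR_ge1Dx _).
  rewrite divfK ?gt_eqF// ler_pdivrMr ?exprn_gt0// natrD -muln2 natrM.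
  rewrite (_ : 1 + 2 / k%:R = (1 + k%:R^-1) + k%:R^-1); last by lra.
  have : 4 * k%:R <= k%:R^-1 * r ^+ 2.
    by rewrite ler_pdivlMl//; nra.
  by move: nq; rewrite /q; nra.
- have := central_binomial_bound k; set b := _ / _ => hb.
  have b0 : 0 <= b by rewrite divr_ge0// exprn_ge0.
  rewrite ler_pdivlMr// mulrC.
  have : (b * expR 2) ^+ 2 <= eta ^+ 2.
    rewrite exprMn; apply: le_trans (_ : b ^+ 2 * (eta ^+ 2 * k%:R) <= _).
      by rewrite ler_wpM2l ?sqr_ge0.
    rewrite mulrCA ler_piMr ?sqr_ge0//; apply: le_trans hb.
    rewrite ler_wpM2l ?sqr_ge0// ler_nat -[in leqRHS]addnn.
    by rewrite -addnS leq_addr.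
  have be0 : 0 <= b * expR 2 by rewrite mulr_ge0// ltW.
  by rewrite (mulrC (expR 2)) ler_pXn2r// nnegrE// ltW.
Qed.

End gaussian_polynomials.

(** * Lebesgue measure on R^n *)

Section borel_lebesgue_integral.
Variable R : realType.
Local Notation lam := (borel_lebesgue R).
Local Notation leb := (@lebesgue_measure R).
Local Open Scope ereal_scope.

Lemma measurable_fun_cons n (f : n.+1.-tuple R -> \bar R) :
  measurable_fun setT f -> measurable_fun setT (f \o @cons_pair R n).
Proof. by move=> mf; apply: measurableT_comp => //; exact: measurable_cons_pair. Qed.

Lemma borel_lebesgue_tonelli n (f : n.+1.-tuple R -> \bar R) :
  measurable_fun setT f -> (forall t, 0 <= f t) ->
  \int[lam n.+1]_t f t = \int[leb]_x \int[lam n]_t f (cons_pair (x, t)).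
Proof.
move=> mf f0.
rewrite (@ge0_integral_pushforward _ _ _ _ R (@cons_pair R n)
  (@measurable_cons_pair R n) (leb \x lam n))//.
rewrite preimage_setT fubini_tonelli1//; first exact: measurable_fun_cons.
by move=> x /=; exact: f0.
Qed.

Lemma borel_lebesgue0 (f : 0.-tuple R -> \bar R) :
  \int[lam 0]_t f t = f [tuple].
Proof.
have mf : measurable_fun setT f.
  by rewrite (_ : f = cst (f [tuple])) //; apply/funext => t; rewrite (tuple0 t).
by rewrite /= integral_dirac// diracE in_setT mul1e.
Qed.

Lemma tnth_cons_pair0 n (p : measurableTypeR R * n.-tuple R) :
  tnth (cons_pair p) ord0 = p.1.
Proof. by rewrite /tnth/=. Qed.

Lemma tnth_cons_pairS n (p : measurableTypeR R * n.-tuple R) i :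
  tnth (cons_pair p) (lift ord0 i) = tnth p.2 i.
Proof. by rewrite /cons_pair (tnthS p.1). Qed.

Lemma measurable_prod_tnth n (f : 'I_n -> R -> R) :
  (forall i, measurable_fun setT (f i)) ->
  measurable_fun setT (fun t : n.-tuple R => (\prod_i f i (tnth t i))%R).
Proof.
move=> mf; apply: measurable_prod => i _.
by apply: measurableT_comp => //; exact: measurable_tnth.
Qed.

Lemma borel_lebesgue_prod n (f : 'I_n -> R -> R) (c : 'I_n -> R) :
  (forall i, measurable_fun setT (f i)) -> (forall i x, 0 <= f i x)%R ->
  (forall i, \int[leb]_x (f i x)%:E = (c i)%:E) ->
  \int[lam n]_t (\prod_i f i (tnth t i))%:E = (\prod_i c i)%:E.
Proof.
elim: n f c => [|n IH] f c mf f0 fc; first by rewrite borel_lebesgue0 !big_ord0.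
rewrite borel_lebesgue_tonelli; last 2 first.
- by apply/measurable_EFinP; exact: measurable_prod_tnth.
- by move=> t; rewrite lee_fin prodr_ge0.
rewrite big_ord_recl EFinM -fc -ge0_integralZr//; last 3 first.
- by apply/measurable_EFinP; exact: mf.
- by move=> x _; rewrite lee_fin.
- rewrite lee_fin prodr_ge0// => i _.
  by rewrite -lee_fin -fc integral_ge0// => x _; rewrite lee_fin.
apply: eq_integral => x _.
under eq_integral => t _.
  rewrite big_ord_recl tnth_cons_pair0/= EFinM.
  under eq_bigr do rewrite tnth_cons_pairS/=.
  over.
rewrite ge0_integralZl//; last 3 first.
- by apply/measurable_EFinP; apply: (measurable_prod_tnth (f := fun i => f (lift ord0 i))).
- by move=> t _; rewrite lee_fin prodr_ge0.
- by rewrite lee_fin.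
by congr (_ * _); apply: (IH (fun i => f (lift ord0 i))).
Qed.

(** The translated measure agrees with Lebesgue measure on half-open intervals, so the two coincide
    by uniqueness. *)
Lemma lebesgue_measure_translation (a : R) (f : measurableTypeR R -> \bar R) :
  measurable_fun setT f -> (forall x, 0 <= f x) ->
  \int[leb]_x f (x + a)%R = \int[leb]_x f x.
Proof.
move=> mf f0.
pose add (x : measurableTypeR R) : measurableTypeR R := (x + a)%R.
have ma : measurable_fun setT add by exact: measurable_funD.
rewrite -(@ge0_integral_pushforward _ _ (measurableTypeR R) (measurableTypeR R) R _ ma leb setT f)//.
apply: (eq_measure_integral leb) => A mA _; apply/esym.
apply: (@lebesgue_measure_unique _
  (measure_function_pushforward__canonical__measure_function_Measure leb ma)) => //.
move=> X /ocitvP[->|[[x y] /= xy ->]]; first by rewrite !measure0.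
rewrite /pushforward.
have -> : add @^-1` `]x, y] = `](x - a)%R, (y - a)%R]%classic.
  by apply/seteqP; split => z /=; rewrite !in_itv/= ltrBlDr lerBrDr.
by rewrite !lebesgue_measure_itv/= !lte_fin ltrD2r; case: ifP => // _; congr EFin; ring.
Qed.

Definition tuple_add n (a t : n.-tuple R) : n.-tuple R :=
  [tuple (tnth t i + tnth a i)%R | i < n].

Lemma tnth_tuple_add n (a t : n.-tuple R) i :
  tnth (tuple_add a t) i = (tnth t i + tnth a i)%R.
Proof. by rewrite tnth_mktuple. Qed.

Lemma measurable_tuple_add n (a : n.-tuple R) :
  measurable_fun setT (tuple_add a).
Proof.
apply/measurable_fun_tnthP => i; rewrite (_ : _ \o _ = fun t => tnth t i + tnth a i)%R.
  by apply: measurable_funD => //; exact: measurable_tnth.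
by apply/funext => t /=; rewrite tnth_mktuple.
Qed.

Lemma tuple_addE n (a : n.+1.-tuple R) (p : measurableTypeR R * n.-tuple R) :
  tuple_add a (cons_pair p) =
  cons_pair ((p.1 + thead a)%R, tuple_add [tuple of behead a] p.2).
Proof.
apply: eq_from_tnth => i; rewrite tnth_mktuple.
case: (unliftP ord0 i) => [j ->|->].
  rewrite !tnth_cons_pairS/= tnth_mktuple tnth_behead; congr (_ + tnth _ _)%R.
  by apply: val_inj; rewrite /= inordK// ltnS.
by rewrite !tnth_cons_pair0.
Qed.

Lemma borel_lebesgue_translation n (a : n.-tuple R) (f : n.-tuple R -> \bar R) :
  measurable_fun setT f -> (forall t, 0 <= f t) ->
  \int[lam n]_t f (tuple_add a t) = \int[lam n]_t f t.
Proof.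
elim: n a f => [|n IH] a f mf f0.
  by rewrite !borel_lebesgue0 (tuple0 (tuple_add _ _)).
have mfa : measurable_fun setT (fun t => f (tuple_add a t)).
  by apply: measurableT_comp => //; exact: measurable_tuple_add.
rewrite (borel_lebesgue_tonelli mfa (fun=> f0 _)) (borel_lebesgue_tonelli mf f0).
have mfc := measurable_fun_cons mf.
under eq_integral => x _.
  under eq_integral do rewrite tuple_addE/=.
  rewrite (IH _ (fun t => f (cons_pair ((x + thead a)%R, t))))//; last first.
    by apply: (measurableT_comp mfc); exact: measurable_pair1.
  over.
rewrite (lebesgue_measure_translation _ (f := fun x => \int[lam n]_t f (cons_pair (x, t))))//.
  exact: (measurable_fun_fubini_tonelli_F _ mfc (fun p => f0 _)).
by move=> x; apply: integral_ge0.
Qed.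

(* [matrix_action] on the Borel space instead of the completed one. *)
Definition tuple_mulmx n (A : 'M[R]_n) (t : n.-tuple R) : n.-tuple R :=
  [tuple (\sum_(j < n) A i j * tnth t j)%R | i < n].

Lemma tuple_mulmxM n (A B : 'M[R]_n) t :
  tuple_mulmx A (tuple_mulmx B t) = tuple_mulmx (A *m B)%R t.
Proof.
apply: eq_from_tnth => i; rewrite !tnth_mktuple.
under eq_bigr do rewrite tnth_mktuple mulr_sumr.
rewrite exchange_big; apply: eq_bigr => j _ /=.
by rewrite mxE mulr_suml; apply: eq_bigr => k _; rewrite mulrA.
Qed.

Lemma tuple_mul1mx n t : @tuple_mulmx n 1%:M%R t = t.
Proof.
apply: eq_from_tnth => i; rewrite tnth_mktuple (bigD1 i)//= big1 ?addr0.
  by rewrite mxE eqxx mul1r.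
by move=> j ji; rewrite mxE eq_sym (negbTE ji) mul0r.
Qed.

Lemma tuple_mulmxD n (A : 'M[R]_n) a t :
  tuple_mulmx A (tuple_add a t) = tuple_add (tuple_mulmx A a) (tuple_mulmx A t).
Proof.
apply: eq_from_tnth => i; rewrite !tnth_mktuple -big_split.
by apply: eq_bigr => j _; rewrite tnth_mktuple mulrDr.
Qed.

Lemma tuple_mulmxN n (A : 'M[R]_n) t i :
  tnth (tuple_mulmx (- A)%R t) i = (- tnth (tuple_mulmx A t) i)%R.
Proof.
rewrite !tnth_mktuple -sumrN; apply: eq_bigr => j _.
by rewrite mxE mulNr.
Qed.

Lemma measurable_tuple_mulmx n (A : 'M[R]_n) :
  measurable_fun setT (tuple_mulmx A).
Proof.
apply/measurable_fun_tnthP => i.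
rewrite (_ : _ \o _ = fun t => \sum_j A i j * tnth t j)%R; last first.
  by apply/funext => t /=; rewrite tnth_mktuple.
apply: measurable_sum => j; apply: measurable_funM => //.
exact: measurable_tnth.
Qed.

Definition gauss_tuple n (t : n.-tuple R) : R := (\prod_i gauss_fun (tnth t i))%R.

Lemma gauss_tuple_mulmx n (A : 'M[R]_n) t : (A^T *m A = 1%:M)%R ->
  gauss_tuple (tuple_mulmx A t) = gauss_tuple t.
Proof.
move=> AA; rewrite /gauss_tuple /gauss_fun -!expR_sum; congr expR.
rewrite !sumrN; congr (- _)%R.
pose u := (\col_i tnth t i)%R : 'cV[R]_n.
have uE v : (v^T *m v) 0%R 0%R = (\sum_i v i 0 ^+ 2)%R :> R.
  by rewrite mxE; apply: eq_bigr => i _; rewrite mxE expr2.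
transitivity (((A *m u)^T *m (A *m u)) 0 0)%R.
  rewrite uE; apply: eq_bigr => i _; rewrite tnth_mktuple mxE; congr (_ ^+ 2)%R.
  by apply: eq_bigr => j _; rewrite mxE.
rewrite trmx_mul -mulmxA (mulmxA A^T%R) AA mul1mx uE.
by apply: eq_bigr => i _; rewrite mxE.
Qed.

Lemma integral_gauss_tuple n :
  \int[lam n]_t (gauss_tuple t)%:E = (Num.sqrt pi ^+ n)%:E.
Proof.
rewrite (@borel_lebesgue_prod n (fun=> gauss_fun) (fun=> Num.sqrt pi))//.
- by rewrite prodr_const card_ord.
- by move=> i; exact: measurable_gauss_fun.
- by move=> i x; exact: gauss_fun_ge0.
- by move=> i; exact: integralT_gauss.
Qed.

Lemma measurable_gauss_tuple n : measurable_fun setT (@gauss_tuple n).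
Proof. by apply: (measurable_prod_tnth (f := fun=> gauss_fun)) => i; exact: measurable_gauss_fun. Qed.

Lemma gauss_tuple_ge0 n (t : n.-tuple R) : (0 <= gauss_tuple t)%R.
Proof. by apply: prodr_ge0 => i _; exact: gauss_fun_ge0. Qed.

Lemma measurable_tuple_add_mulmx n (A B : 'M[R]_n) :
  measurable_fun setT (fun p : n.-tuple R * n.-tuple R =>
    tuple_add (tuple_mulmx A p.2) (tuple_mulmx B p.1)).
Proof.
apply/measurable_fun_tnthP => i.
rewrite (_ : _ \o _ = fun p => tnth (tuple_mulmx B p.1) i + tnth (tuple_mulmx A p.2) i)%R; last first.
  by apply/funext => t /=; rewrite tnth_mktuple.
apply: measurable_funD.
  exact: (measurableT_comp (measurable_tnth i)
    (measurableT_comp (measurable_tuple_mulmx B) measurable_fst)).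
exact: (measurableT_comp (measurable_tnth i)
  (measurableT_comp (measurable_tuple_mulmx A) measurable_snd)).
Qed.

(* Uniqueness of Haar measure: integrate f(x) g(x + Ay) over (x, y) in both
   orders, where g is a Gaussian, so that g o A = g. *)
Lemma borel_lebesgue_orthogonal n (A : 'M[R]_n) (f : n.-tuple R -> \bar R) :
  (A *m A^T = 1%:M)%R -> measurable_fun setT f -> (forall t, 0 <= f t) ->
  \int[lam n]_t f (tuple_mulmx A t) = \int[lam n]_t f t.
Proof.
move=> AA mf f0.
(* The argument treats f(- A t), the form produced by the shift of x by - A y; hence the passage to
   [- A]. *)
wlog suff : / \int[lam n]_t f (tuple_mulmx (- - A)%R t) = \int[lam n]_t f t.
  by rewrite opprK.
have {AA} : (- A *m (- A)^T = 1%:M)%R by rewrite linearN/= mulNmx mulmxN opprK.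
move: (- A)%R => {}A AA; have AA' := mulmx1C AA.
pose g := @gauss_tuple n; pose G := (Num.sqrt pi ^+ n)%R : R.
have G0 : (0 < G)%R by rewrite exprn_gt0// sqrtr_gt0 pi_gt0.
have mg : measurable_fun setT (EFin \o g).
  by apply/measurable_EFinP; exact: measurable_gauss_tuple.
have g0 t : 0 <= (g t)%:E by rewrite lee_fin gauss_tuple_ge0.
have gA t : g (tuple_mulmx A t) = g t by exact: gauss_tuple_mulmx.
have mfA : measurable_fun setT (fun t => f (tuple_mulmx (- A)%R t)).
  by apply: measurableT_comp => //; exact: measurable_tuple_mulmx.
have If0 : 0 <= \int[lam n]_t f t by exact: integral_ge0.
suff : G%:E * \int[lam n]_t f t = G%:E * \int[lam n]_t f (tuple_mulmx (- A)%R t).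
  move=> /(congr1 (fun z => G^-1%:E * z)).
  by rewrite !muleA -EFinM mulVf ?gt_eqF// !mul1e.
transitivity (\int[lam n]_x \int[lam n]_y (f x * (g (tuple_add (tuple_mulmx A y) x))%:E)).
  rewrite -ge0_integralZl//; last by rewrite lee_fin ltW.
  apply: eq_integral => x _.
  (* Writing x + A y as A (A^T x + y), invariance of g under A and of the measure under translations
     makes the integral in y independent of x. *)
  have xE y : tuple_add (tuple_mulmx A y) x =
      tuple_mulmx A (tuple_add (tuple_mulmx A^T x) y).
    rewrite tuple_mulmxD tuple_mulmxM AA tuple_mul1mx.
    by apply: eq_from_tnth => i; rewrite !tnth_mktuple addrC.
  under eq_integral do rewrite xE gA.
  rewrite ge0_integralZl//; last first.
    by apply: measurableT_comp mg _; exact: measurable_tuple_add.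
  rewrite (@borel_lebesgue_translation n _ (EFin \o g))//.
  by rewrite integral_gauss_tuple muleC.
pose h (p : n.-tuple R * n.-tuple R) := f p.1 * (g (tuple_add (tuple_mulmx A p.2) p.1))%:E.
have mgA : measurable_fun setT (fun p : n.-tuple R * n.-tuple R =>
    (g (tuple_add (tuple_mulmx A p.2) p.1))%:E).
  apply: (measurableT_comp mg).
  have := measurable_tuple_add_mulmx A 1%:M%R.
  by under eq_fun do rewrite tuple_mul1mx.
have mh : measurable_fun setT h.
  by apply: emeasurable_funM => //; exact: measurableT_comp.
have h0 p : 0 <= h p by exact: mule_ge0.
transitivity (\int[lam n]_y \int[lam n]_x h (x, y)).
  exact: (fubini_tonelli h mh h0).
have yE (y x : n.-tuple R) : tuple_add (tuple_mulmx A y) (tuple_add (tuple_mulmx (- A)%R y) x) = x.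
  apply: eq_from_tnth => i; rewrite 2!tnth_tuple_add tuple_mulmxN.
  by rewrite subrK.
transitivity (\int[lam n]_y \int[lam n]_x (f (tuple_add (tuple_mulmx (- A)%R y) x) * (g x)%:E)).
  apply: eq_integral => y _.
  transitivity (\int[lam n]_x h (tuple_add (tuple_mulmx (- A)%R y) x, y)).
    apply/esym/(@borel_lebesgue_translation n _ (fun x => h (x, y))) => //.
    by apply: (measurableT_comp mh); exact: measurable_pair2.
  by apply: eq_integral => x _; rewrite /h/= yE.
pose k (p : n.-tuple R * n.-tuple R) := f (tuple_add (tuple_mulmx (- A)%R p.2) p.1) * (g p.1)%:E.
have mk : measurable_fun setT k.
  apply: emeasurable_funM; last exact: (measurableT_comp mg).
  apply: (measurableT_comp mf).
  have := measurable_tuple_add_mulmx (- A)%R 1%:M%R.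
  by under eq_fun do rewrite tuple_mul1mx.
have k0 p : 0 <= k p by exact: mule_ge0.
transitivity (\int[lam n]_x \int[lam n]_y k (x, y)).
  by apply/esym; exact: (fubini_tonelli k mk k0).
rewrite -integral_gauss_tuple.
rewrite -ge0_integralZr//; last exact: integral_ge0.
apply: eq_integral => x _ /=.
have xE y : tuple_add (tuple_mulmx (- A)%R y) x =
    tuple_mulmx (- A)%R (tuple_add (tuple_mulmx (- A^T)%R x) y).
  rewrite tuple_mulmxD tuple_mulmxM mulNmx mulmxN opprK AA tuple_mul1mx.
  by apply: eq_from_tnth => i; rewrite !tnth_mktuple addrC.
rewrite /k/=.
under eq_integral do rewrite xE.
rewrite ge0_integralZr//; last first.
  by apply: (measurableT_comp mfA); exact: measurable_tuple_add.
by rewrite (@borel_lebesgue_translation n _ (fun t => f (tuple_mulmx (- A)%R t)))// muleC.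
Qed.

End borel_lebesgue_integral.

(** * Transfer between the Borel measure and its completion *)

Section lebesgue_borel.
Variables (R : realType) (d : nat).
Local Notation lam := (borel_lebesgue R d).
Local Notation mu := (@lebesgue R d).
Local Open Scope ereal_scope.

(** The identity, seen as a measurable map from the completed sigma-algebra to the Borel one, so
    that integrals can be transferred by pushforward. *)
Definition euclidean_tuple (x : euclidean R d) : d.-tuple R := x.

Lemma measurable_euclidean_tuple : measurable_fun setT euclidean_tuple.
Proof.
move=> _ B mB; rewrite setTI.
by apply: (@sub_caratheodory _ _ _ lam B); exact: sub_sigma_algebra.
Qed.

Lemma lebesgue_borel (B : set (d.-tuple R)) : measurable B -> mu B = lam B.
Proof. by move=> mB; exact: measurable_mu_extE. Qed.

Lemma measurable_fun_euclidean d' (T : measurableType d') (f : d.-tuple R -> T) :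
  measurable_fun setT f -> measurable_fun setT (f : euclidean R d -> T).
Proof. by move=> mf; exact: (measurableT_comp mf measurable_euclidean_tuple). Qed.

Lemma integral_lebesgue_borel (f : d.-tuple R -> \bar R) :
  measurable_fun setT f -> (forall t, 0 <= f t) ->
  \int[mu]_x f x = \int[lam]_t f t.
Proof.
move=> mf f0.
transitivity (\int[pushforward mu euclidean_tuple]_t f t).
  by rewrite (ge0_integral_pushforward measurable_euclidean_tuple).
apply: (eq_measure_integral lam); first exact: measurable_euclidean_tuple.
by move=> ? B mB _; exact: lebesgue_borel.
Qed.

Lemma integrable_lebesgue_borel (f : d.-tuple R -> \bar R) :
  lam.-integrable setT f -> mu.-integrable setT f.
Proof.
move=> /integrableP[mf fi]; apply/integrableP; split.
  exact: measurable_fun_euclidean.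
by rewrite (@integral_lebesgue_borel (fun t => `|f t|))//; exact: measurableT_comp.
Qed.

Lemma Rintegral_lebesgue_borel (f : d.-tuple R -> R) :
  measurable_fun setT f -> (\int[mu]_x f x = \int[lam]_t f t)%R.
Proof.
move=> mf; rewrite /Rintegral; congr fine; rewrite integralE [RHS]integralE.
have mf' : measurable_fun setT (EFin \o f) by exact/measurable_EFinP.
rewrite (@integral_lebesgue_borel (EFin \o f)^\+)//; last exact: measurable_funepos.
by rewrite (@integral_lebesgue_borel (EFin \o f)^\-)//; exact: measurable_funeneg.
Qed.

(** For an arbitrary set [E], [mu E] is the infimum of the masses of its Borel covers. This supplies
    a Borel set standing in for the part of A(omega) in a box. *)
Lemma lebesgue_outer_regular (E : set (euclidean R d)) (c : \bar R) :
  mu E < c -> exists B : set (d.-tuple R), [/\ measurable B, E `<=` B & lam B < c].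
Proof.
move=> /ereal_inf_lt[_ [F [mF EF] <-] Fc]; exists (\bigcup_k F k); split => //.
  exact: bigcupT_measurable.
apply: le_lt_trans Fc; apply: (@measure_sigma_subadditive _ _ _ lam) => //.
exact: bigcupT_measurable.
Qed.

End lebesgue_borel.

Section signed_product.
Variable R : realType.
Local Notation lam := (borel_lebesgue R).
Local Notation leb := (@lebesgue_measure R).
Local Open Scope ereal_scope.

(** The signed form of [borel_lebesgue_prod], for the products psi_m psi_n, which change sign.
    Integrability follows from the nonnegative case applied to absolute values, and allows
    Fubini. *)
Lemma borel_lebesgue_prod_integrable n (f : 'I_n -> measurableTypeR R -> R) :
  (forall i, leb.-integrable setT (EFin \o f i)) ->
  (lam n).-integrable setT (fun t => (\prod_i f i (tnth t i))%:E) /\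
  (\int[lam n]_t (\prod_i f i (tnth t i)) = \prod_i \int[leb]_x f i x)%R.
Proof.
have mprod k (g : 'I_k -> measurableTypeR R -> R) :
  (forall i, leb.-integrable setT (EFin \o g i)) ->
  measurable_fun setT (fun t : k.-tuple R => (\prod_i g i (tnth t i))%:E).
  move=> ig; apply/measurable_EFinP; apply: (measurable_prod_tnth (f := g)) => i.
  by apply/measurable_EFinP; exact: (measurable_int _ (ig i)).
have iprod k (g : 'I_k -> measurableTypeR R -> R) :
  (forall i, leb.-integrable setT (EFin \o g i)) ->
  (lam k).-integrable setT (fun t => (\prod_i g i (tnth t i))%:E).
  move=> ig; apply/integrableP; split; first exact: mprod.
  under eq_integral do rewrite /= normr_prod.
  rewrite (@borel_lebesgue_prod R k (fun i x => `|g i x|%R) (fun i => fine (\int[leb]_x `|g i x|%:E)))//.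
  - by rewrite ltry.
  - by move=> i; apply: measurableT_comp => //; apply/measurable_EFinP; exact: (measurable_int _ (ig i)).
  - move=> i; rewrite fineK// ge0_fin_numE; last exact: integral_ge0.
    by have /integrableP[] := ig i.
elim: n f => [|n IH] f fi; split; try exact: iprod.
  by rewrite /Rintegral borel_lebesgue0 !big_ord0.
have [] := IH (fun i => f (lift ord0 i)) (fun i => fi _) => ij Ej.
pose F (t : n.+1.-tuple R) := (\prod_i f i (tnth t i))%:E.
have iF : (lam n.+1).-integrable setT F by exact: iprod.
have mF : measurable_fun setT F := measurable_int _ iF.
have mFc : measurable_fun setT (F \o @cons_pair R n) := measurable_fun_cons mF.
have iFc : (leb \x lam n).-integrable setT (F \o @cons_pair R n).
  apply/integrableP; split => //; have /integrableP[_] := iF.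
  have mF' := measurableT_comp (@abse_measurable R setT) mF.
  by rewrite (@ge0_integral_pushforward _ _ _ _ R _ (@measurable_cons_pair R n) (leb \x lam n))//.
rewrite big_ord_recl -Ej.
transitivity (fine (\int[leb \x lam n]_p (F \o @cons_pair R n) p)).
  rewrite /Rintegral; congr fine.
  by rewrite (integral_pushforward (@measurable_cons_pair R n) mF iFc).
rewrite -integral12_prod_meas1//.
rewrite -RintegralZr//; congr fine; apply: eq_integral => x _.
rewrite /fubini_F; under eq_integral => t _.
  rewrite /F/= big_ord_recl tnth_cons_pair0/= EFinM.
  under eq_bigr do rewrite tnth_cons_pairS/=.
  over.
rewrite integralZl//= EFinM; congr (_ * _).
by rewrite fineK//; exact: integrable_fin_num ij.
Qed.

End signed_product.

(** * Real square integrable functions *)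

Section square_integrable.
Context d (T : measurableType d) (R : realType) (mu : {measure set T -> \bar R}).
Implicit Types f g : T -> R.

(** Complex functions are split into real and imaginary parts, because all test functions are
    real. *)
Definition sqint f := measurable_fun setT f /\
  mu.-integrable setT (fun x => (f x ^+ 2)%:E).

Definition dot f g : R := \int[mu]_x (f x * g x).

Lemma sqint_mul f g : sqint f -> sqint g ->
  mu.-integrable setT (fun x => (f x * g x)%:E).
Proof.
move=> [mf fi] [mg gi].
have := integrableD measurableT fi gi.
apply: le_integrable => //.
  by apply/measurable_EFinP; exact: measurable_funM.
move=> x _; rewrite lee_fin [leRHS]ger0_norm ?addr_ge0 ?sqr_ge0//.
by rewrite ler_norml; apply/andP; split; move: (f x) (g x) => a b; nra.
Qed.

Lemma sqintZ c f : sqint f -> sqint (fun x => c * f x).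
Proof.
move=> [mf fi]; split; first exact: measurable_funM.
apply: eq_integrable (integrableZl measurableT (c ^+ 2) fi) => // x _.
by rewrite exprMn.
Qed.

Lemma sqintD f g : sqint f -> sqint g -> sqint (fun x => f x + g x).
Proof.
move=> sf sg; have fgi := sqint_mul sf sg; case: sf sg => [mf fi] [mg gi].
split; first exact: measurable_funD.
have := integrableD measurableT (integrableD measurableT fi gi) (integrableZl measurableT 2 fgi).
apply: eq_integrable => // x _; rewrite -EFinM -!EFinD; congr EFin; ring.
Qed.

Lemma sqintN f : sqint f -> sqint (fun x => - f x).
Proof. by move=> /(sqintZ (-1)); under eq_fun do rewrite mulN1r. Qed.

Lemma sqintB f g : sqint f -> sqint g -> sqint (fun x => f x - g x).
Proof. by move=> sf sg; apply: sqintD => //; exact: sqintN. Qed.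

Lemma sqint0 : sqint (fun=> 0).
Proof.
split => //; rewrite expr0n/=; exact: integrable0.
Qed.

Lemma sqint_sum (I : Type) (s : seq I) (f : I -> T -> R) :
  (forall i, sqint (f i)) -> sqint (fun x => \sum_(i <- s) f i x).
Proof.
move=> sf; elim: s => [|i s IH].
  by under eq_fun do rewrite big_nil; exact: sqint0.
by under eq_fun do rewrite big_cons; exact: sqintD.
Qed.

Lemma dotE f g : sqint f -> sqint g ->
  (\int[mu]_x (f x * g x)%:E = (dot f g)%:E)%E.
Proof. by move=> sf sg; rewrite fineK// integrable_fin_num//; exact: sqint_mul. Qed.

Lemma dotC f g : dot f g = dot g f.
Proof. by apply: eq_Rintegral => x _; rewrite mulrC. Qed.

Lemma dotDl f g h : sqint f -> sqint g -> sqint h ->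
  dot (fun x => f x + g x) h = dot f h + dot g h.
Proof.
move=> sf sg sh; rewrite /dot -RintegralD//; try exact: sqint_mul.
by apply: eq_Rintegral => x _; rewrite mulrDl.
Qed.

Lemma dotZl c f g : sqint f -> sqint g -> dot (fun x => c * f x) g = c * dot f g.
Proof.
move=> sf sg; rewrite /dot -RintegralZl//; last exact: sqint_mul.
by apply: eq_Rintegral => x _; rewrite mulrA.
Qed.

Lemma dotBl f g h : sqint f -> sqint g -> sqint h ->
  dot (fun x => f x - g x) h = dot f h - dot g h.
Proof.
move=> sf sg sh; rewrite /dot -RintegralB//; try exact: sqint_mul.
by apply: eq_Rintegral => x _; rewrite mulrBl.
Qed.

Lemma dot_suml (I : Type) (s : seq I) (f : I -> T -> R) g :
  (forall i, sqint (f i)) -> sqint g ->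
  dot (fun x => \sum_(i <- s) f i x) g = \sum_(i <- s) dot (f i) g.
Proof.
move=> sf sg; elim: s => [|i s IH].
  rewrite big_nil /dot; under eq_Rintegral do rewrite big_nil mul0r.
  by rewrite Rintegral_cst// mul0r.
rewrite big_cons -IH -dotDl//; last exact: sqint_sum.
by apply: eq_Rintegral => x _; rewrite big_cons.
Qed.

Lemma dot_sqr_ge0 f : 0 <= dot f f.
Proof. by apply: Rintegral_ge0 => x _; rewrite -expr2 sqr_ge0. Qed.

(** Young's inequality. Its free weight [e] will balance the cost of the control against the mass on
    [omega]. *)
Lemma dot_le e f g : 0 < e -> sqint f -> sqint g ->
  `|dot f g| <= e^-1 / 2 * dot f f + e / 2 * dot g g.
Proof.
move=> e0 sf sg; have ffi := sqint_mul sf sf; have ggi := sqint_mul sg sg.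
have fi := integrableZl measurableT (e^-1 / 2) ffi.
have gi := integrableZl measurableT (e / 2) ggi.
rewrite /dot -RintegralZl// -RintegralZl// -RintegralD//.
apply: le_trans (le_normr_Rintegral _ _) _ => //; first exact: sqint_mul.
apply: le_Rintegral => //; first exact: (integrable_abse (sqint_mul sf sg)).
  exact: (integrableD measurableT fi gi).
move=> x _; have -> : e^-1 / 2 * (f x * f x) + e / 2 * (g x * g x) =
    (f x ^+ 2 + (e * g x) ^+ 2) / (2 * e) by field; rewrite gt_eqF.
rewrite ler_pdivlMr; last by rewrite mulr_gt0.
rewrite -[X in _ * X](gtr0_norm (_ : 0 < 2 * e)) ?mulr_gt0// -normrM ler_norml.
have := sqr_ge0 (f x + e * g x); have := sqr_ge0 (f x - e * g x).
by move: (f x) (g x) => u v h1 h2; apply/andP; split; lra.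
Qed.

Local Open Scope ereal_scope.

Lemma L2norm_sqr (f : T -> R[i]) :
  \int[mu]_x ((complex.Re (f x) ^+ 2 + complex.Im (f x) ^+ 2)%:E)%R = (L2norm mu f) `^ 2.
Proof.
rewrite /L2norm powR_Lnorm//; apply: eq_integral => x _.
rewrite gee0_abs; last by case: (f x) => a b; rewrite lee_fin sqrtr_ge0.
rewrite poweR_EFin -[2%R]/(2%:R) powR_mulrn; last by case: (f x) => a b; rewrite sqrtr_ge0.
by case: (f x) => a b; rewrite sqr_sqrtr// addr_ge0 ?sqr_ge0.
Qed.

Lemma L2_sqint (f : T -> R[i]) : L2 mu f ->
  sqint (fun x => complex.Re (f x)) /\ sqint (fun x => complex.Im (f x)).
Proof.
move=> [mR mI fi].
have mS : measurable_fun setT (fun x => (complex.Re (f x) ^+ 2 + complex.Im (f x) ^+ 2)%:E)%R.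
  by apply/measurable_EFinP; apply: measurable_funD; exact: measurable_funX.
have iS : mu.-integrable setT (fun x => (complex.Re (f x) ^+ 2 + complex.Im (f x) ^+ 2)%:E)%R.
  apply/integrableP; split => //.
  under eq_integral do rewrite gee0_abs ?lee_fin ?addr_ge0 ?sqr_ge0//.
  by rewrite L2norm_sqr poweR_lty.
split; split => //; apply: le_integrable iS => //;
  try (by apply/measurable_EFinP; exact: measurable_funX);
  by move=> x _; rewrite lee_fin !ger0_norm ?addr_ge0 ?sqr_ge0// ?lerDl ?lerDr ?sqr_ge0.
Qed.

(** Cauchy-Schwarz against a function of norm at most one. The norm is an extended real, so the
    bound also makes sense for the errors of approximation before they are known to be finite. *)
Lemma L2norm_dot (f : T -> R[i]) g :
  measurable_fun setT (fun x => complex.Re (f x)) ->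
  measurable_fun setT (fun x => complex.Im (f x)) ->
  sqint g -> (dot g g <= 1)%R ->
  (`|dot (fun x => complex.Re (f x)) g|%R)%:E <= L2norm mu f.
Proof.
move=> mR mI sg g1; have N0 : 0 <= L2norm mu f by exact: Lnorm_ge0.
have [->|fi] := eqVneq (L2norm mu f) +oo; first by rewrite leey.
have {fi} fL : L2 mu f by split => //; rewrite ltey.
have [sR sI] := L2_sqint fL.
have NE : L2norm mu f = (fine (L2norm mu f))%:E.
  by rewrite fineK// ge0_fin_numE//; case: fL.
have := L2norm_sqr f; rewrite NE; set r := fine _ => rE.
have r0 : (0 <= r)%R by exact: fine_ge0.
have dR : (dot (fun x => complex.Re (f x)) (fun x => complex.Re (f x)) <= r ^+ 2)%R.
  rewrite -lee_fin -dotE// -(@powR_mulrn _ r 2)// -poweR_EFin -rE.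
  apply: ge0_le_integral => //.
  - by move=> x _; rewrite lee_fin -expr2 sqr_ge0.
  - by apply/measurable_EFinP; exact: measurable_funM.
  - by apply/measurable_EFinP; apply: measurable_funD; exact: measurable_funX.
  - by move=> x _; rewrite lee_fin -expr2 lerDl sqr_ge0.
(* The weight [e + r] stays positive even when the norm [r] is zero. *)
rewrite lee_fin; apply/ler_addgt0Pl => e e0.
have re0 : (0 < e + r)%R by rewrite ltr_wpDr.
apply: le_trans (dot_le re0 sR sg) _.
have rE' : (e + r = (e + r)^-1 / 2 * (e + r) ^+ 2 + (e + r) / 2 * 1)%R.
  by field; rewrite gt_eqF.
rewrite [leRHS]rE'.
apply: lerD; rewrite ler_wpM2l ?divr_ge0 ?invr_ge0 ?(ltW re0)//.
by apply: le_trans dR _; rewrite lerXn2r ?nnegrE ?lerDr// ltW.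
Qed.

Lemma L2norm_real (f : T -> R) : sqint f ->
  L2norm mu (fun x => (f x)%:C%C) = (Num.sqrt (dot f f))%:E.
Proof.
move=> sf; have := L2norm_sqr (fun x => (f x)%:C%C).
under eq_integral do rewrite /= expr0n addr0 expr2.
rewrite dotE// => /esym E.
have N0 : 0 <= L2norm mu (fun x => (f x)%:C%C) by exact: Lnorm_ge0.
have fi : L2norm mu (fun x => (f x)%:C%C) \is a fin_num.
  by rewrite ge0_fin_numE// (@lty_poweRy _ _ 2)// E ltry.
move: N0 E; rewrite -(fineK fi) lee_fin poweR_EFin => r0 [].
by rewrite -[2%R]/(2%:R) powR_mulrn// => <-; rewrite sqrtr_sqr ger0_norm.
Qed.

Lemma L2_real (f : T -> R) : sqint f -> L2 mu (fun x => (f x)%:C%C).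
Proof.
move=> sf; split => //; first by case: sf.
by rewrite L2norm_real// ltry.
Qed.

End square_integrable.

(** * Rotated Hermite functions *)

Section hermite_tensors.
Variables (R : realType) (d : nat).
Local Notation mu := (@lebesgue R d).
Local Notation leb := (@lebesgue_measure R).
Implicit Types a b : {ffun 'I_d -> nat}.

Definition hermite_prod a (t : d.-tuple R) : R :=
  \prod_(i < d) hermite_function (a i) (tnth t i).

Lemma hermite_tensorE a (x : euclidean R d) :
  hermite_tensor a x = (hermite_prod a x)%:C%C.
Proof. by []. Qed.

Lemma integrable_hermite_functionM m n :
  leb.-integrable setT (EFin \o (fun x => hermite_function m x * hermite_function n x)).
Proof.
apply: eq_integrable (integrable_horner_gauss (normalized_hermite R m * normalized_hermite R n)) => //.
by move=> x _; rewrite /= hermite_functionM.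
Qed.

Lemma integral_hermite_functionM m n :
  \int[leb]_x (hermite_function m x * hermite_function n x) = (m == n)%:R.
Proof.
rewrite -gauss_integral_normalized; apply: eq_Rintegral => x _.
by rewrite hermite_functionM.
Qed.

Lemma measurable_hermite_function n :
  measurable_fun setT (@hermite_function R n).
Proof.
rewrite (_ : @hermite_function R n = fun x => (normalized_hermite R n).[x] * expR (- (x ^+ 2 / 2))); last first.
  by apply/funext => x; rewrite hermite_functionE.
apply: measurable_funM.
  by apply: continuous_measurable_fun; exact: continuous_horner.
apply: measurableT_comp => //; apply: measurableT_comp => //.
by apply: measurable_funM => //; exact: measurable_funX.
Qed.

Lemma measurable_hermite_prod a : measurable_fun setT (hermite_prod a).
Proof.
apply: (measurable_prod_tnth (f := fun i => @hermite_function R (a i))) => i.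
exact: measurable_hermite_function.
Qed.

Lemma hermite_prodM a b t : hermite_prod a t * hermite_prod b t =
  \prod_i (hermite_function (a i) (tnth t i) * hermite_function (b i) (tnth t i)).
Proof. by rewrite big_split. Qed.

Lemma sqint_hermite_prod a : sqint mu (hermite_prod a).
Proof.
split; first exact: (measurable_fun_euclidean (measurable_hermite_prod a)).
apply: (@integrable_lebesgue_borel _ _ (fun t => (hermite_prod a t ^+ 2)%:E)).
have [+ _] := @borel_lebesgue_prod_integrable R d
  (fun i x => hermite_function (a i) x * hermite_function (a i) x)
  (fun i => integrable_hermite_functionM _ _).
by apply: eq_integrable => // t _; rewrite expr2 hermite_prodM.
Qed.

Lemma dot_hermite_prod a b : dot mu (hermite_prod a) (hermite_prod b) = (a == b)%:R.
Proof.
have mab : measurable_fun setT (fun t => hermite_prod a t * hermite_prod b t).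
  by apply: measurable_funM; exact: measurable_hermite_prod.
rewrite /dot (Rintegral_lebesgue_borel mab).
under eq_Rintegral do rewrite hermite_prodM.
have [_ ->] := @borel_lebesgue_prod_integrable R d
  (fun i x => hermite_function (a i) x * hermite_function (b i) x)
  (fun i => integrable_hermite_functionM _ _).
under eq_bigr do rewrite integral_hermite_functionM.
have [<-|ab] := eqVneq a b; first by rewrite big1// => i _; rewrite eqxx.
have [i abi] : exists i, a i != b i.
  apply/existsP; apply: contraNT ab; rewrite negb_exists => /forallP ab.
  by apply/eqP/ffunP => i; apply/eqP; rewrite -[_ == _]negbK.
by rewrite (bigD1 i)//= (negbTE abi) mul0r.
Qed.

Lemma dot_mulmx (A : 'M[R]_d) (f g : d.-tuple R -> R) : A *m A^T = 1%:M ->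
  measurable_fun setT f -> measurable_fun setT g ->
  dot mu (fun x => f (tuple_mulmx A x)) (fun x => g (tuple_mulmx A x)) = dot mu f g.
Proof.
move=> AA mf mg; have mA := @measurable_tuple_mulmx R d A.
have mfg : measurable_fun setT (fun t => (f t * g t)%:E).
  by apply/measurable_EFinP; exact: measurable_funM.
rewrite /dot.
have -> : \int[mu]_x (f (tuple_mulmx A x) * g (tuple_mulmx A x)) =
    \int[borel_lebesgue R d]_x (f (tuple_mulmx A x) * g (tuple_mulmx A x)).
  apply: (@Rintegral_lebesgue_borel R d (fun x => f (tuple_mulmx A x) * g (tuple_mulmx A x))).
  by apply/measurable_EFinP; exact: (measurableT_comp mfg mA).
have -> : \int[mu]_x (f x * g x) = \int[borel_lebesgue R d]_x (f x * g x).
  by apply: Rintegral_lebesgue_borel; exact: measurable_funM.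
rewrite /Rintegral; congr fine; rewrite integralE [RHS]integralE; congr (_ - _)%E.
  by rewrite -(borel_lebesgue_orthogonal AA (measurable_funepos mfg))//; apply: eq_integral => x _; rewrite !funeposE.
by rewrite -(borel_lebesgue_orthogonal AA (measurable_funeneg mfg))//; apply: eq_integral => x _; rewrite !funenegE.
Qed.

Lemma gauss_half_mulmx (A : 'M[R]_d) t : A^T *m A = 1%:M ->
  \prod_i expR (- (tnth (tuple_mulmx A t) i ^+ 2 / 2)) =
  \prod_i expR (- (tnth t i ^+ 2 / 2)) :> R.
Proof.
move=> AA; have h u : \prod_i expR (- (tnth u i ^+ 2 / 2)) = Num.sqrt (gauss_tuple u) :> R.
  have p0 : 0 <= \prod_i expR (- (tnth u i ^+ 2 / 2)) :> R.
    by apply: prodr_ge0 => i _; exact: expR_ge0.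
  rewrite -[LHS](ger0_norm p0) -sqrtr_sqr -prodrXl; congr Num.sqrt; apply: eq_bigr => i _.
  by rewrite -expRM_natl /gauss_fun; congr expR; field.
by rewrite !h gauss_tuple_mulmx.
Qed.

(** The identity for polynomials carries over: the Gaussian factor is invariant under [A], and the
    normalizing constants go into the coefficients. *)
Lemma hermite_prod_mulmx (A : 'M[R]_d) a : A *m A^T = 1%:M ->
  exists s : seq {ffun 'I_d -> nat}, exists c : {ffun 'I_d -> nat} -> R,
    (forall b, b \in s -> multi_degree b = multi_degree a) /\
    forall t, hermite_prod a (tuple_mulmx A t) = \sum_(b <- s) c b * hermite_prod b t.
Proof.
move=> AA; have AA' := mulmx1C AA.
have [//|s [c [sd sE]]] := @Rotation.hermite_rotation R
  (fun n x => (hermite_poly R n).[x]) _ (@hermite_polyS R) d A AA a.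
  by move=> x; rewrite hornerC.
pose K b : R := \prod_(i < d) hermite_const R (b i).
have K0 b : K b != 0.
  by rewrite gt_eqF// prodr_gt0// => i _; exact: hermite_const_gt0.
exists s, (fun b => K a * c b / K b); split => // t.
have hE b u : hermite_prod b u = K b * \prod_i expR (- (tnth u i ^+ 2 / 2))
    * \prod_i (hermite_poly R (b i)).[tnth u i].
  rewrite -!big_split; apply: eq_bigr => i _ /=.
  by rewrite hermite_functionE normalized_hermiteE hornerZ mulrAC.
rewrite hE gauss_half_mulmx//.
have -> : \prod_i (hermite_poly R (a i)).[tnth (tuple_mulmx A t) i] =
    \sum_(b <- s) c b * \prod_i (hermite_poly R (b i)).[tnth t i].
  by rewrite -sE; apply: eq_bigr => i _; rewrite tnth_mktuple.
rewrite mulr_sumr; apply: eq_bigr => b _.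
by rewrite hE; move: (K b) (K0 b) => k k0; field.
Qed.

(** The eigenfunction Psi_a o A, whose mass on omega is that of Psi_a on A(omega). *)
Definition hermite_rotated (A : 'M[R]_d) a (x : euclidean R d) : R :=
  hermite_prod a (tuple_mulmx A x).

Lemma sqint_hermite_rotated A a : A *m A^T = 1%:M -> sqint mu (hermite_rotated A a).
Proof.
move=> /(hermite_prod_mulmx a)[s [c [_ sE]]].
rewrite (_ : hermite_rotated A a = fun t => \sum_(b <- s) c b * hermite_prod b t).
  by apply: sqint_sum => b; apply: sqintZ; exact: sqint_hermite_prod.
by apply/funext => t; exact: sE.
Qed.

Lemma dot_hermite_rotated A a b : A *m A^T = 1%:M ->
  dot mu (hermite_rotated A a) (hermite_rotated A b) = (a == b)%:R.
Proof.
by move=> AA; rewrite dot_mulmx ?dot_hermite_prod//; exact: measurable_hermite_prod.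
Qed.

Local Notation ReF f := (fun x => complex.Re (f x)).
Local Notation ImF f := (fun x => complex.Im (f x)).

Lemma L2inner_hermite_tensor (f : euclidean R d -> R[i]) b :
  L2inner mu f (hermite_tensor b) =
  (dot mu (ReF f) (hermite_prod b) +i* dot mu (ImF f) (hermite_prod b))%C.
Proof.
rewrite /L2inner /complex_integral /dot; congr (_ +i* _)%C; apply: eq_Rintegral => x _;
by rewrite hermite_tensorE; case: (f x) => u v /=; ring.
Qed.

(** A finite partial sum within [e] of [g] and containing the index [b] pairs with Psi_b, by
    orthogonality, to the single coefficient e^(-i theta) <f, Psi_b>; its real part is the
    right-hand side. *)
Lemma frac_harmonic_group_dot s t (f g : euclidean R d -> R[i]) b :
  frac_harmonic_group s t f g ->
  let theta := t * (2 * multi_degree b + d)%:R `^ s in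
  dot mu (ReF g) (hermite_prod b) =
    cos theta * dot mu (ReF f) (hermite_prod b)
    + sin theta * dot mu (ImF f) (hermite_prod b).
Proof.
move=> [fL gL fg] theta; apply/eqP; rewrite -subr_eq0 -normr_le0.
apply/ler_addgt0Pl => e e0; rewrite addr0.
have [A0 A0e] := fg _ e0.
pose A := (b |` A0)%fset; have bA : b \in A by rewrite !inE eqxx.
pose F (a : {ffun 'I_d -> nat}) (x : euclidean R d) : R[i] :=
  expi (- (t * (2 * multi_degree a + d)%:R `^ s)) *
  L2inner mu f (hermite_tensor a) * hermite_tensor a x.
pose D x := g x - \sum_(a <- A) F a x.
have De : (L2norm mu D < e%:E)%E by exact: (A0e A (fsubsetU1 _ _)).
have [sRg sIg] := L2_sqint gL.
pose co a : R[i] := expi (- (t * (2 * multi_degree a + d)%:R `^ s)) * L2inner mu f (hermite_tensor a).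
have coE : complex.Re (co b) = cos theta * dot mu (ReF f) (hermite_prod b)
    + sin theta * dot mu (ImF f) (hermite_prod b).
  by rewrite /co L2inner_hermite_tensor /expi cosN sinN /= -/theta; ring.
have ReFE a x : complex.Re (F a x) = complex.Re (co a) * hermite_prod a x.
  by rewrite /F hermite_tensorE -/(co a); case: (co a) => u v /=; ring.
have ImFE a x : complex.Im (F a x) = complex.Im (co a) * hermite_prod a x.
  by rewrite /F hermite_tensorE -/(co a); case: (co a) => u v /=; ring.
have ReD : ReF D = fun x => complex.Re (g x) - \sum_(a <- A) complex.Re (co a) * hermite_prod a x.
  apply/funext => x; rewrite /D raddfB raddf_sum; congr (_ - _).
  by apply: eq_bigr => a _; exact: ReFE.
have ImD : ImF D = fun x => complex.Im (g x) - \sum_(a <- A) complex.Im (co a) * hermite_prod a x.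
  apply/funext => x; rewrite /D raddfB raddf_sum; congr (_ - _).
  by apply: eq_bigr => a _; exact: ImFE.
have sS (z : {ffun 'I_d -> nat} -> R) : sqint mu (fun x => \sum_(a <- A) z a * hermite_prod a x).
  by apply: sqint_sum => a; apply: sqintZ; exact: sqint_hermite_prod.
have := @L2norm_dot _ _ _ mu D (hermite_prod b) _ _ (sqint_hermite_prod b) _.
rewrite ReD ImD dot_hermite_prod eqxx => /(_ _ _ (lexx _)) h.
have {h} := h (sqintB sRg (sS _)).1 (sqintB sIg (sS _)).1.
move=> /le_lt_trans/(_ De); rewrite lte_fin dotBl//; last exact: sqint_hermite_prod.
rewrite (@dot_suml _ _ _ mu _ A (fun a x => complex.Re (co a) * hermite_prod a x)); last 2 first.
- by move=> a; apply: sqintZ; exact: sqint_hermite_prod.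
- exact: sqint_hermite_prod.
rewrite (eq_bigr (fun a => complex.Re (co a) * (a == b)%:R)); last first.
  move=> a _; rewrite (dotZl _ (sqint_hermite_prod a) (sqint_hermite_prod b)).
  by rewrite dot_hermite_prod.
rewrite (big_fsetD1 b)//= eqxx mulr1 big_seq big1 ?addr0; last first.
  by move=> a; rewrite !inE => /andP[ab _]; rewrite (negbTE ab) mulr0.
move=> /ltW; apply: le_trans; rewrite le_eqVlt; apply/orP; left; apply/eqP; congr `|_ - _|.
exact: esym coE.
Qed.

(** The rotated function combines tensors Psi_b with the same total degree as [a], which therefore
    share the phase [theta]. *)
Lemma frac_harmonic_group_rotated s t (f g : euclidean R d -> R[i]) A a :
  A *m A^T = 1%:M -> frac_harmonic_group s t f g ->
  let theta := t * (2 * multi_degree a + d)%:R `^ s in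
  dot mu (ReF g) (hermite_rotated A a) =
    cos theta * dot mu (ReF f) (hermite_rotated A a)
    + sin theta * dot mu (ImF f) (hermite_rotated A a).
Proof.
move=> AA fg theta; have [r [c [rd rE]]] := hermite_prod_mulmx a AA.
have [[sRf sIf] [sRg sIg]] : (sqint mu (ReF f) /\ sqint mu (ImF f)) /\
    (sqint mu (ReF g) /\ sqint mu (ImF g)).
  by case: fg => /L2_sqint ? /L2_sqint ? _.
have E w : sqint mu w -> dot mu w (hermite_rotated A a) = \sum_(b <- r) c b * dot mu w (hermite_prod b).
  move=> sw; rewrite dotC (_ : hermite_rotated A a = fun t => \sum_(b <- r) c b * hermite_prod b t).
    rewrite (@dot_suml _ _ _ mu _ r (fun b t => c b * hermite_prod b t) w); last 2 first.
    - by move=> b; apply: sqintZ; exact: sqint_hermite_prod.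
    - exact: sw.
    by apply: eq_bigr => b _; rewrite (dotZl _ (sqint_hermite_prod b) sw) dotC.
  by apply/funext => x; exact: rE.
rewrite !E// !mulr_sumr -big_split big_seq [RHS]big_seq; apply: eq_bigr => b br /=.
by rewrite (frac_harmonic_group_dot b fg) (rd b br) -/theta; ring.
Qed.

End hermite_tensors.

(** * The observability estimate *)

Section bochner_dot.
Context d (T : measurableType d) (R : realType) (mu : {measure set T -> \bar R}).
Local Open Scope ereal_scope.

(* Unlike in [ge0_le_integral], [f] and [g] need not be measurable. *)
Lemma ge0_le_integral_restrict d' (X : measurableType d') (nu : {measure set X -> \bar R})
    (D1 D2 : set X) (f g : X -> \bar R) :
  (forall x, D1 x -> 0 <= f x) -> (forall x, D2 x -> 0 <= g x) ->
  D1 `<=` D2 -> (forall x, D1 x -> f x <= g x) ->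
  \int[nu]_(x in D1) f x <= \int[nu]_(x in D2) g x.
Proof.
move=> f0 g0 D12 fg; rewrite integral_mkcond [leRHS]integral_mkcond.
have fD0 : forall x, 0 <= (f \_ D1) x by exact: erestrict_ge0.
have gD0 : forall x, 0 <= (g \_ D2) x by exact: erestrict_ge0.
rewrite !ge0_integralTE//; apply: ereal_sup_le => _ [h hf <-].
exists h => // x; apply: le_trans (hf x) _.
rewrite !patchE; case: ifPn => x1.
  by rewrite mem_set; [apply: fg; rewrite inE in x1|apply: D12; rewrite inE in x1].
by case: ifPn => // x2; apply: g0; rewrite inE in x2.
Qed.

Local Notation ReF f := (fun x => complex.Re (f x)).
Local Notation leb := (@lebesgue_measure R).

(** [W] is accessible only through its simple approximants. Paired with [phi] they become real step
    functions [s n], whose integrals tend to the pairing of [b], while |s n| <= B + N n almost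
    everywhere on [D]. *)
Lemma bochner_dot_le (D : set (measurableTypeR R)) (W : R -> T -> R[i]) (b : T -> R[i])
    (phi : T -> R) (B : measurableTypeR R -> \bar R) :
  measurable D -> sqint mu phi -> (dot mu phi phi <= 1)%R ->
  is_bochner_integral mu D W b ->
  measurable_fun setT B -> (forall t, 0 <= B t) ->
  {ae leb, forall t, D t -> L2 mu (W t) /\ (`|dot mu (ReF (W t)) phi|%R)%:E <= B t} ->
  (`|dot mu (ReF b) phi|%R)%:E <= \int[leb]_(t in D) B t.
Proof.
move=> mD sphi phi1 [bL [m [E [h [Eh _ cvN cvb]]]]] mB B0 aeB.
pose S n t x := (\sum_(k < m n) (\1_(E n k) t)%:C%C * h n k x)%R.
pose N n t := L2norm mu (fun x => (W t x - S n t x)%R).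
pose p n k := dot mu (ReF (h n k)) phi.
pose s n (t : measurableTypeR R) := (\sum_(k < m n) p n k * \1_(E n k) t)%R.
have sh n k : sqint mu (ReF (h n k)).
  by have [_ _ _ /L2_sqint[]] := Eh n k.
have shI n k : sqint mu (fun x => complex.Im (h n k x)).
  by have [_ _ _ /L2_sqint[]] := Eh n k.
have Re_sum n (c : nat -> R) x :
    complex.Re (\sum_(k < m n) (c k)%:C%C * h n k x)%R = (\sum_(k < m n) c k * complex.Re (h n k x))%R.
  by rewrite raddf_sum; apply: eq_bigr => k _; case: (h n k x) => u v /=; rewrite mul0r subr0.
have Im_sum n (c : nat -> R) x :
    complex.Im (\sum_(k < m n) (c k)%:C%C * h n k x)%R = (\sum_(k < m n) c k * complex.Im (h n k x))%R.
  by rewrite raddf_sum; apply: eq_bigr => k _; case: (h n k x) => u v /=; rewrite mul0r addr0.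
(* Pairing with [phi] does not increase the norm. This serves twice: with indicators at a fixed time
   for [W t], and with the measures of the [E n k] for [b]. *)
have combo n (c : nat -> R) (f : T -> R[i]) : L2 mu f ->
    (`|dot mu (ReF f) phi - \sum_(k < m n) c k * p n k|%R)%:E
    <= L2norm mu (fun x => (f x - \sum_(k < m n) (c k)%:C%C * h n k x)%R).
  move=> /L2_sqint[sR sI].
  have sS : sqint mu (fun x => \sum_(k < m n) c k * complex.Re (h n k x))%R.
    by apply: sqint_sum => k; exact: sqintZ.
  have sSI : sqint mu (fun x => \sum_(k < m n) c k * complex.Im (h n k x))%R.
    by apply: sqint_sum => k; exact: sqintZ.
  set F := fun x => (f x - _)%R.
  have ReFE : ReF F = (fun x => complex.Re (f x) - \sum_(k < m n) c k * complex.Re (h n k x))%R.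
    by apply/funext => x; rewrite /F raddfB; congr (_ - _)%R; exact: Re_sum.
  have ImFE : (fun x => complex.Im (F x)) = (fun x => complex.Im (f x) - \sum_(k < m n) c k * complex.Im (h n k x))%R.
    by apply/funext => x; rewrite /F raddfB; congr (_ - _)%R; exact: Im_sum.
  have := @L2norm_dot _ _ _ mu F phi; rewrite ReFE ImFE => hF.
  apply: le_trans (hF (sqintB sR sS).1 (sqintB sI sSI).1 sphi phi1).
  rewrite dotBl// (@dot_suml _ _ _ mu _ _ (fun (k : 'I_(m n)) x => c k * complex.Re (h n k x))%R)//.
    by rewrite [X in _ <= (`|_ - X|%R)%:E](eq_bigr (fun k : 'I_(m n) => c k * p n k)%R)// => k _; rewrite dotZl.
  by move=> k; exact: sqintZ.
have ms n : measurable_fun setT (s n).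
  apply: measurable_sum => k; apply: measurable_funM => //.
  by apply: measurable_indic; have [] := Eh n k.
have i01 n k : leb.-integrable D (fun t => (\1_(E n k) t)%:E).
  have [mE _ Efin _] := Eh n k.
  apply/integrableP; split; first by apply/measurable_EFinP; exact: measurable_indic.
  under eq_integral do rewrite gee0_abs//.
  rewrite integral_indic//; apply: le_lt_trans Efin.
  by apply: le_measure; rewrite ?inE//; exact: measurableI.
have i1 n k : leb.-integrable D (fun t => (p n k)%:E * (\1_(E n k) t)%:E).
  by apply: integrableZl.
have sE n t : (s n t)%:E = \sum_(k < m n) ((p n k)%:E * (\1_(E n k) t)%:E).
  by rewrite -sumEFin; apply: eq_bigr => k _; rewrite EFinM.
have is_ n : leb.-integrable D (EFin \o s n).
  under [X in _.-integrable _ X]eq_fun do rewrite /= sE.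
  by apply: integrable_sum => // k _; exact: i1.
have Is n : (\int[leb]_(t in D) s n t = \sum_(k < m n) fine (leb (E n k)) * p n k)%R.
  rewrite /Rintegral (eq_integral _ _ (fun t _ => sE n t)) integral_sum//.
  rewrite -[RHS]/(fine (_)%:E) -sumEFin; congr fine; apply: eq_bigr => k _.
  have [mE ED Efin _] := Eh n k.
  rewrite integralZl//.
  have Ef : leb (E n k) \is a fin_num by rewrite ge0_fin_numE// measure_ge0.
  by rewrite integral_indic// setIidl// EFinM (fineK Ef) [RHS]muleC.
have sN n : \int[leb]_(t in D) (`|s n t|%R)%:E <= \int[leb]_(t in D) B t + \int[leb]_(t in D) N n t.
  (* [N n] is not known to be measurable, so the integrand [B] plus a measurable
     defect [q] is used to dominate [`|s n|]. *)
  pose q t := maxe 0 ((`|s n t|%R)%:E - B t).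
  have q0 t : 0 <= q t by rewrite le_max lexx.
  have mq : measurable_fun setT q.
    apply: measurable_maxe => //; apply: emeasurable_funB => //.
    by apply/measurable_EFinP; exact: measurableT_comp.
  have qN : \int[leb]_(t in D) q t <= \int[leb]_(t in D) N n t.
    have [Z [mZ Z0 Zsub]] := aeB.
    rewrite (@ge0_negligible_integral _ _ _ _ D Z)//; last exact: measurable_funTS.
    apply: ge0_le_integral_restrict => //.
    + by move=> x _; exact: Lnorm_ge0.
    + move=> t [Dt nZt].
      have [WL WB] : L2 mu (W t) /\ (`|dot mu (ReF (W t)) phi|%R)%:E <= B t.
        by apply: contrapT => h'; apply: nZt; apply: Zsub => /(_ Dt).
      rewrite ge_max Lnorm_ge0/=.
      have := combo n (fun k => \1_(E n k) t) _ WL.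
      have -> : (\sum_(k < m n) \1_(E n k) t * p n k = s n t)%R.
        by apply: eq_bigr => k _; rewrite mulrC.
      rewrite -/(S n t) -/(N n t); case: (B t) WB => [r| |]//=; last by rewrite leNye.
      rewrite lee_fin => WB; apply: le_trans; rewrite -EFinB lee_fin lerBlDr.
      rewrite distrC; apply: le_trans (_ : _ <= `|s n t - dot mu (ReF (W t)) phi| + `|dot mu (ReF (W t)) phi|)%R _; last exact: lerD.
      by rewrite -{1}(subrK (dot mu (ReF (W t)) phi) (s n t)) ler_normD.
  apply: le_trans (_ : _ <= \int[leb]_(t in D) (B t + q t)) _.
    apply: ge0_le_integral_restrict => //.
    + by move=> x _; rewrite adde_ge0.
    + move=> t _; rewrite /q; case: (B t) (B0 t) => [r| |]// r0; last first.
        by rewrite addye ?leey// -ltNye (lt_le_trans (ltNyr 0))// le_max lexx.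
      rewrite -EFinB /maxe; case: ifPn => [_|].
        by rewrite -EFinD lee_fin addrC subrK.
      by rewrite lte_fin subr_gt0 -leNgt adde0 lee_fin.
  rewrite ge0_integralD//; try exact: measurable_funTS.
  by rewrite leeD2l.
apply/lee_addgt0Pr => e e0.
have e20 : (0 < e / 2)%R by rewrite divr_gt0.
have near0 (u : nat -> \bar R) : u @ \oo --> 0 -> \forall n \near \oo, u n < (e / 2)%:E.
  move=> cvu; have := cvu [set y | y < (e / 2)%:E]; apply.
  by apply: open_nbhs_nbhs; split; [exact: open_ereal_lt_ereal|rewrite /= lte_fin].
near \oo => n.
have h1 : L2norm mu (fun x => b x - \sum_(k < m n) (fine (leb (E n k)))%:C%C * h n k x)%R < (e / 2)%:E.
  by near: n; exact: near0.
have h2 : \int[leb]_(t in D) N n t < (e / 2)%:E by near: n; exact: near0.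
have := combo n (fun k => fine (leb (E n k))) _ bL.
rewrite -Is => /le_lt_trans/(_ h1); rewrite lte_fin => h3.
apply: le_trans (_ : (`|\int[leb]_(t in D) s n t|%R + e / 2)%:E <= _).
  by rewrite lee_fin -lerBlDl (le_trans _ (ltW h3))// lerB_dist.
rewrite EFinD [leRHS](_ : _ = \int[leb]_(t in D) B t + (e / 2)%:E + (e / 2)%:E); last first.
  by rewrite -addeA -EFinD -splitr.
rewrite leeD2r//.
apply: le_trans (_ : _ <= \int[leb]_(t in D) (`|s n t|%R)%:E) _.
  have := le_normr_Rintegral mD (is_ n).
  rewrite -lee_fin => /le_trans; apply; rewrite /Rintegral fineK//.
  by apply: integrable_fin_num => //; exact: integrable_abse (is_ n).
by apply: le_trans (sN n) _; rewrite leeD2l// ltW.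
Unshelve. all: by end_near. Qed.

End bochner_dot.

Section sqint_indic.
Context d (T : measurableType d) (R : realType) (nu : {measure set T -> \bar R}).

Lemma ae_eq_dot (f g h : T -> R) :
  measurable_fun setT f -> measurable_fun setT g -> measurable_fun setT h ->
  {ae nu, forall x, f x = g x} -> dot nu f h = dot nu g h.
Proof.
move=> mf mg mh fg; rewrite /dot /Rintegral; congr fine.
apply: ae_eq_integral => //.
- by apply/measurable_EFinP; exact: measurable_funM.
- by apply/measurable_EFinP; exact: measurable_funM.
- by apply: filterS fg => x -> _.
Qed.

Lemma sqint_indic (A : set T) (f : T -> R) :
  measurable A -> sqint nu f -> sqint nu (fun x => \1_A x * f x).
Proof.
move=> mA [mf fi].
have mAf : measurable_fun setT (fun x => \1_A x * f x).
  by apply: measurable_funM => //; exact: measurable_indic.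
split => //; apply: le_integrable fi => //.
  by apply/measurable_EFinP; exact: measurable_funX.
move=> x _; rewrite lee_fin !ger0_norm ?sqr_ge0// exprMn ler_piMl ?sqr_ge0//.
Qed.

(** An indicator equals its square, so the cutoff carried by the control can also be put on the test
    function. *)
Lemma dot_indicr (A : set T) (f g : T -> R) :
  dot nu (fun x => \1_A x * f x) g =
  dot nu (fun x => \1_A x * f x) (fun x => \1_A x * g x).
Proof.
apply: eq_Rintegral => x _; rewrite mulrACA -mulrA.
by rewrite indicE; case: (_ \in _); rewrite ?mul1r ?mul0r.
Qed.

Lemma dotD_le_integral (f g H : T -> R) : sqint nu f -> sqint nu g ->
  (forall x, f x * f x + g x * g x <= H x) ->
  ((dot nu f f + dot nu g g)%:E <= \int[nu]_x (H x)%:E)%E.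
Proof.
move=> sf sg fgH; rewrite EFinD -!dotE// -ge0_integralD//.
- apply: ge0_le_integral_restrict => //.
  + by move=> x _; rewrite -EFinD lee_fin -!expr2 addr_ge0 ?sqr_ge0.
  + by move=> x _; rewrite lee_fin; apply: le_trans (fgH x); rewrite -!expr2 addr_ge0 ?sqr_ge0.
  + by move=> x _; rewrite -EFinD lee_fin.
- by move=> x _; rewrite lee_fin -expr2 sqr_ge0.
- by apply/measurable_EFinP; apply: measurable_funM; exact: sf.1.
- by move=> x _; rewrite lee_fin -expr2 sqr_ge0.
- by apply/measurable_EFinP; apply: measurable_funM; exact: sg.1.
Qed.

End sqint_indic.

Section mild_solution.
Variables (R : realType) (d : nat).
Local Notation mu := (@lebesgue R d).
Local Notation leb := (@lebesgue_measure R).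
Local Notation ReF f := (fun x => complex.Re (f x)).
Local Notation ImF f := (fun x => complex.Im (f x)).

(** From a zero initial datum only the Duhamel term remains. At almost every time its integrand
    pairs with [phi] through a cosine and a sine, both bounded by 1, and Young's inequality
    separates the control from the mass on [omega]. *)
Lemma mild_solution_dot_le (s T delta : R) (omega : set (euclidean R d))
    (u : measurableTypeR R * euclidean R d -> R[i]) (f : R -> euclidean R d -> R[i]) A a :
  measurable omega -> A *m A^T = 1%:M -> 0 <= T -> 0 < delta ->
  L2 (leb \x mu)%E u ->
  is_mild_solution (@frac_harmonic_group R d s) omega (fun=> 0) u T f ->
  let phi := hermite_rotated A a in
  `|dot mu (ReF (f T)) phi| <=
    delta / 2 * (\int[(leb \x mu)%E]_p (complex.Re (u p) ^+ 2 + complex.Im (u p) ^+ 2))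
    + delta^-1 * T * dot mu (fun x => \1_omega x * phi x) (fun x => \1_omega x * phi x).
Proof.
move=> mo AA T0 delta0 uL fsol; cbv zeta; set phi := hermite_rotated A a.
have sphi : sqint mu phi by exact: sqint_hermite_rotated.
set psi := fun x => \1_omega x * phi x.
have spsi : sqint mu psi by exact: sqint_indic.
have [a0 [b [W [Ua aeU Wb [fTL fTE]]]]] := fsol T (introT andP (conj T0 (lexx T))).
have La0 : L2 mu a0 by case: Ua.
have Lb : L2 mu b by case: Wb.
have [[sfR _] [[saR _] [sbR _]]] := (L2_sqint fTL, (L2_sqint La0, L2_sqint Lb)).
have -> : dot mu (ReF (f T)) phi = dot mu (ReF b) phi.
  rewrite (@ae_eq_dot _ _ _ _ _ (fun x => complex.Re (a0 x) + complex.Re (b x))).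
  - rewrite dotDl// (frac_harmonic_group_rotated a AA Ua)/=.
    rewrite /dot; under eq_Rintegral do rewrite mul0r.
    by rewrite Rintegral_cst// mul0r !mulr0 !add0r.
  - exact: sfR.1.
  - by apply: measurable_funD; [exact: saR.1|exact: sbR.1].
  - exact: sphi.1.
  - by apply: filterS fTE => x ->; exact: raddfD.
have [uR uI] := L2_sqint uL.
pose F (p : measurableTypeR R * euclidean R d) : \bar R :=
  ((complex.Re (u p) ^+ 2 + complex.Im (u p) ^+ 2)%:E)%R.
have F0 p : (0 <= F p)%E by rewrite lee_fin addr_ge0 ?sqr_ge0.
have mF : measurable_fun setT F.
  apply/measurable_EFinP; apply: measurable_funD; apply: measurable_funX.
    exact: uR.1.
  exact: uI.1.
have iF : (leb \x mu)%E.-integrable setT F.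
  by have := integrableD measurableT uR.2 uI.2; apply: eq_integrable.
pose G t := (\int[mu]_x F (t, x))%E.
have G0 t : (0 <= G t)%E by apply: integral_ge0 => x _.
have mG : measurable_fun setT G by exact: measurable_fun_fubini_tonelli_F.
(* Young's inequality with weight [delta^-1] is applied to the real and to the imaginary part: the
   two halves of [delta^-1] add up. Integration in time gives the squared norm of [u] and a factor
   [T]. *)
pose B t := ((delta / 2)%:E * G t + (delta^-1 * dot mu psi psi)%:E)%E.
have c0 : 0 <= delta^-1 * dot mu psi psi by rewrite mulr_ge0 ?dot_sqr_ge0// invr_ge0 ltW.
have d20 : 0 <= delta / 2 by rewrite divr_ge0 ?ltW.
have mdG : measurable_fun setT (fun t => ((delta / 2)%:E * G t)%E).
  exact: measurable_funeM.
have mB : measurable_fun setT B by exact: emeasurable_funD.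
have B0 t : (0 <= B t)%E by rewrite adde_ge0 ?lee_fin// mule_ge0 ?lee_fin.
have -> : (\int[(leb \x mu)%E]_p (complex.Re (u p) ^+ 2 + complex.Im (u p) ^+ 2)
  = fine (\int[(leb \x mu)%E]_p F p)%E) by [].
rewrite -lee_fin.
apply: le_trans (@bochner_dot_le _ _ _ mu `]0, T[%classic W b phi B _ _ _ _ _ _ _) _ => //.
- by rewrite dot_hermite_rotated// eqxx.
- have [Z [mZ Z0 Zsub]] := aeU; exists Z; split => // t; apply: contra_notP => nZt Dt.
  have {}hU := contrapT (fun h => nZt (Zsub t h)).
  have {hU}hU := hU Dt.
  have [uL' WL _] := hU; split => //.
  have [s1 s2] := L2_sqint uL'.
  rewrite (frac_harmonic_group_rotated a AA hU).
  set f1 := fun x => complex.Re _ in s1 *.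
  set f2 := fun x => complex.Im _ in s2 *.
  set th := ((T - t) * _)%R.
  have f1E x : f1 x = (\1_omega x * complex.Re (u (t, x)))%R.
    by rewrite /f1; case: (u (t, x)) => v w /=; rewrite mul0r subr0.
  have f2E x : f2 x = (\1_omega x * complex.Im (u (t, x)))%R.
    by rewrite /f2; case: (u (t, x)) => v w /=; rewrite mul0r addr0.
  have d1 : dot mu f1 phi = dot mu f1 psi by rewrite (funext f1E) dot_indicr.
  have d2 : dot mu f2 phi = dot mu f2 psi by rewrite (funext f2E) dot_indicr.
  rewrite -/phi d1 d2.
  have di : (0 < delta^-1)%R by rewrite invr_gt0.
  have h1 := dot_le di s1 spsi; have h2 := dot_le di s2 spsi.
  have hG : ((dot mu f1 f1 + dot mu f2 f2)%:E <= G t)%E.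
    apply: dotD_le_integral => // x; rewrite f1E f2E -!expr2.
    by rewrite indicE; case: (_ \in _); rewrite ?mul1r// !mul0r expr0n/= addr0 addr_ge0 ?sqr_ge0.
  rewrite /B; apply: le_trans (_ : _ <= (delta / 2)%:E * (dot mu f1 f1 + dot mu f2 f2)%:E + (delta^-1 * dot mu psi psi)%:E)%E _; last first.
    by rewrite leeD2r// lee_wpmul2l.
  rewrite -EFinM -EFinD lee_fin.
  apply: le_trans (ler_normD _ _) _; rewrite !normrM.
  apply: le_trans (_ : _ <= `|dot mu f1 psi| + `|dot mu f2 psi|)%R _.
    by apply: lerD; rewrite ler_piMl// ler_norml ?cos_geN1 ?cos_le1 ?sin_geN1 ?sin_le1.
  apply: le_trans (lerD h1 h2) _; rewrite invrK.
  by rewrite -subr_ge0 [leRHS](_ : _ = 0)%R//; field; rewrite gt_eqF.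
- have mD : measurable (`]0, T[%classic : set (measurableTypeR R)) by exact: measurable_itv.
  rewrite ge0_integralD//; last 2 first.
  + by move=> t _; rewrite mule_ge0 ?lee_fin.
  + exact: measurable_funTS.
  rewrite ge0_integralZl//; last exact: measurable_funTS.
  rewrite integral_cst// EFinD.
  rewrite [X in (_ + _ * X <= _)%E](_ : _ = T%:E); last first.
    apply: etrans (lebesgue_measure_itv `]0, T[) _; rewrite /= lte_fin; case: ifPn => //; first by rewrite oppr0 adde0.
    by rewrite -leNgt => T0'; congr EFin; apply/eqP; rewrite eq_le T0 T0'.
  rewrite -EFinM (mulrAC _ _ T) leeD2r// [leRHS]EFinM fineK; last by apply: integrable_fin_num.
  rewrite lee_wpmul2l// fubini_tonelli1//.
  by apply: ge0_subset_integral.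
Qed.

End mild_solution.

Section orthonormal_series.
Context d (T : measurableType d) (R : realType) (mu : {measure set T -> \bar R}).

(** Cauchy-Schwarz for the weights 2^-k, whose total is at most 2. *)
Lemma geometric_sum_sqr_le (u : nat -> R) n :
  (\sum_(k < n) 2^-1 ^+ k * u k) ^+ 2 <= 2 * \sum_(k < n) 2^-1 ^+ k * u k ^+ 2.
Proof.
elim: n u => [|n IH] u; first by rewrite !big_ord0 mulr0 expr0n.
rewrite !big_ord_recl !expr0 !mul1r.
under eq_bigr do rewrite lift0 exprS -mulrA.
under [in leRHS]eq_bigr do rewrite lift0 exprS -mulrA.
rewrite -!mulr_sumr; have := IH (fun k => u k.+1); set x0 := u ord0.
move: (\sum_(i < n) _) (\sum_(i < n) _) => a b ab.
have := sqr_ge0 (x0 - 2^-1 * b); lra.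
Qed.

(* The series sum_k 2^-k phi_k converges pointwise where sum_k 2^-k phi_k^2 is
   finite, and its square is at most twice the latter sum; no completeness of L^2
   is needed. *)
Lemma orthonormal_series (phi : nat -> T -> R) :
  (forall k, sqint mu (phi k)) ->
  (forall j k, dot mu (phi j) (phi k) = (j == k)%:R) ->
  exists2 f, sqint mu f & forall k, dot mu f (phi k) = 2^-1 ^+ k.
Proof.
move=> sphi ophi.
pose w k : R := 2^-1 ^+ k.
have w0 k : 0 < w k by rewrite exprn_gt0// invr_gt0.
have w2 n : \sum_(k < n) w k <= 2.
  have -> : \sum_(k < n) w k = 2 - 2 * w n.
    elim: n => [|n IH]; first by rewrite big_ord0 /w expr0 mulr1 subrr.
    by rewrite big_ord_recr/= IH /w exprS; field.
  by rewrite lerBlDr lerDl mulr_ge0// ltW.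
pose g k x := ((w k * phi k x ^+ 2)%:E)%E.
have g0 k x : (0 <= g k x)%E by rewrite lee_fin mulr_ge0 ?sqr_ge0// ltW.
have mg k : measurable_fun setT (g k).
  by apply/measurable_EFinP; apply: measurable_funM => //; apply: measurable_funX; exact: (sphi k).1.
pose G x := (\sum_(k <oo) g k x)%E.
have G0 x : (0 <= G x)%E by exact: nneseries_ge0.
have mG : measurable_fun setT G.
  by apply: (ge0_emeasurable_sum (P := xpredT)).
have Ig k : (\int[mu]_x g k x = (w k)%:E)%E.
  have := dotE (sqintZ (w k) (sphi k)) (sphi k); rewrite dotZl// ophi eqxx mulr1 => <-.
  by apply: eq_integral => x _; rewrite /g expr2 mulrA.
have IG : (\int[mu]_x G x < +oo)%E.
  rewrite integral_nneseries//; apply: le_lt_trans (ltry 2).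
  apply: lime_le; first by apply: is_cvg_nneseries => k _ _; exact: integral_ge0.
  apply: nearW => n; rewrite big_mkord (eq_bigr (fun k : 'I_n => (w k)%:E)) => [|k _]; last exact: Ig.
  by rewrite sumEFin lee_fin; exact: w2.
have iG : mu.-integrable setT G.
  by apply/integrableP; split => //; under eq_integral do rewrite gee0_abs//.
have gG n x : (\sum_(k < n) g k x <= G x)%E.
  by have := @nneseries_lim_ge R (g ^~ x) xpredT 0 n; rewrite big_mkord; apply=> k _ _.
pose D := [set x | (G x < +oo)%E].
have mD : measurable D.
  by rewrite -[D]setTI; exact: emeasurable_fun_infty_o.
pose S n x := \sum_(k < n) w k * phi k x.
have mS n : measurable_fun setT (S n).
  by apply: measurable_sum => k; apply: measurable_funM => //; exact: (sphi k).1.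
have S2 n x : ((S n x ^+ 2)%:E <= 2%:E * G x)%E.
  apply: le_trans (_ : _ <= 2%:E * \sum_(k < n) g k x)%E _; last by rewrite lee_wpmul2l.
  rewrite sumEFin -EFinM lee_fin; exact: (geometric_sum_sqr_le (phi ^~ x)).
have cvS x : D x -> cvgn (S ^~ x).
  move=> Dx; have GE : G x = (fine (G x))%:E by rewrite fineK// ge0_fin_numE.
  have -> : S ^~ x = series (fun k => w k * phi k x).
    by apply/funext => n; rewrite /S /series/= big_mkord.
  apply: normed_cvg; apply: nondecreasing_is_cvgn.
    by apply: nondecreasing_series => k _ _; exact: normr_ge0.
  exists (2 + fine (G x)) => _ [n _ <-]; rewrite -[leLHS]/(\sum_(0 <= k < n) `|w k * phi k x|) big_mkord.
  (* Since |phi_k| <= 1 + phi_k^2, finiteness of [G x] forces absolute convergence. *)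
  apply: le_trans (_ : _ <= \sum_(k < n) w k + \sum_(k < n) w k * phi k x ^+ 2) _.
    rewrite -big_split/=; apply: ler_sum => k _; rewrite normrM (gtr0_norm (w0 k)).
    rewrite -[X in X + _]mulr1 -mulrDr ler_wpM2l//; first exact: ltW.
    have := sqr_ge0 (`|phi k x| - 1); rewrite -(real_normK (num_real (phi k x))).
    by have := normr_ge0 (phi k x); nra.
  by apply: lerD => //; rewrite -lee_fin -GE -sumEFin; exact: gG.
(* Cutting off by [D] makes the limit exist at every point, which gives measurability of [f]. *)
pose f x := limn (fun n => \1_D x * S n x).
have cvf x : (fun n => \1_D x * S n x) @ \oo --> f x.
  suff : cvgn (fun n => \1_D x * S n x) by [].
  rewrite indicE.
  have [xD|xD] := boolP (x \in D).
    under eq_fun do rewrite mul1r.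
    by apply: cvS; rewrite inE in xD.
  under eq_fun do rewrite mul0r.
  exact: is_cvg_cst.
have mDS n : measurable_fun setT (fun x => \1_D x * S n x).
  by apply: measurable_funM => //; exact: measurable_indic.
have mf : measurable_fun setT f.
  exact: (measurable_fun_cvg (h := fun n x => \1_D x * S n x)).
have DS2 n x : (((\1_D x * S n x) ^+ 2)%:E <= 2%:E * G x)%E.
  rewrite indicE; case: (_ \in _); rewrite ?mul1r//.
  by rewrite mul0r expr0n/= mule_ge0.
have f2 x : ((f x ^+ 2)%:E <= 2%:E * G x)%E.
  have cv2 : (fun n => ((\1_D x * S n x) ^+ 2)%:E) @ \oo --> (f x ^+ 2)%:E.
    by apply/cvg_EFin; [exact: nearW|rewrite expr2; under eq_fun do rewrite expr2; apply: cvgM; exact: cvf].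
  rewrite -(cvg_lim _ cv2)//; apply: lime_le; first by apply/cvg_ex; exists (f x ^+ 2)%:E.
  exact: nearW.
have sf : sqint mu f.
  split => //; apply: le_integrable (integrableZl measurableT 2 iG) => //.
    by apply/measurable_EFinP; exact: measurable_funX.
  move=> x _; rewrite gee0_abs ?lee_fin ?sqr_ge0// gee0_abs ?f2//.
  by rewrite mule_ge0.
exists f => // j.
have aeD : {ae mu, forall x, D x}.
  by apply: filterS (integrable_ae measurableT iG) => x /(_ I); rewrite ge0_fin_numE.
(* A majorant of every |S_n phi_j|, because |S_n phi_j| <= (S_n^2 + phi_j^2) / 2 and S_n^2 <= 2
   G. *)
pose H x := (G x + (phi j x ^+ 2)%:E)%E.
have [] := @dominated_convergence _ _ _ mu setT measurableT (fun n x => (S n x * phi j x)%:E)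
  (fun x => (f x * phi j x)%:E) H.
- by move=> n; apply/measurable_EFinP; apply: measurable_funM => //; exact: (sphi j).1.
- by apply/measurable_EFinP; apply: measurable_funM => //; exact: (sphi j).1.
- apply: filterS aeD => x Dx _; apply/cvg_EFin; first exact: nearW.
  suff : (fun n => S n x) @ \oo --> f x by move=> cv; apply: (cvgM cv (cvg_cst _)).
  have := cvf x; rewrite indicE mem_set//.
  by under eq_fun do rewrite mul1r.
- exact: (integrableD measurableT iG (sphi j).2).
- apply: nearW => x n _; rewrite /H.
  have := S2 n x; case: (G x) (G0 x) => [r| |]//; last by move=> _ _; rewrite addye ?leey.
  rewrite !lee_fin => r0 h; rewrite normrM.
  have := sqr_ge0 (`|S n x| - `|phi j x|).
  rewrite -(real_normK (num_real (phi j x))).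
  move: h; rewrite -(real_normK (num_real (S n x))).
  have := sqr_ge0 `|phi j x|.
  by move: `|_| `|_| => a b; nra.
move=> _ _; have sS n : dot mu (S n) (phi j) = if (j < n)%N then w j else 0.
  rewrite (@dot_suml _ _ _ mu _ _ (fun (k : 'I_n) x => w k * phi k x))//; last by move=> k; exact: sqintZ.
  under eq_bigr do rewrite dotZl// ophi.
  case: ifPn => [jn|].
    rewrite (bigD1 (Ordinal jn))//= eqxx mulr1 big1 ?addr0// => k /negPf kj.
    by rewrite (_ : (k : nat) == j = false) ?mulr0//; apply: contraFF kj => /eqP kj; exact/eqP/val_inj.
  rewrite -leqNgt => nj; rewrite big1// => k _.
  by rewrite ltn_eqF ?mulr0// (leq_trans (ltn_ord k)).
rewrite (_ : [sequence _]_n = fun n => (if (j < n)%N then w j else 0)%:E); last first.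
  apply/funext => n /=; rewrite dotE ?sS//.
  by apply: sqint_sum => k; exact: sqintZ.
rewrite dotE// => cv1.
have cv2 : (fun n => (if (j < n)%N then w j else 0)%:E) @ \oo --> (w j)%:E.
  apply: cvg_near_cst; exists j.+1 => // n /= jn; by rewrite jn.
by apply: EFin_inj; rewrite -(cvg_lim _ cv1)// (cvg_lim _ cv2).
Qed.

End orthonormal_series.

Section lower_bound.
Variables (R : realType) (d : nat).
Local Notation mu := (@lebesgue R d).

Lemma controllable_hermite_mass (s : R) (omega : set (euclidean R d)) (T : R) (A : 'M[R]_d) (i0 : 'I_d) :
  measurable omega -> 0 <= T -> A *m A^T = 1%:M ->
  exactly_controllable (@frac_harmonic_group R d s) omega T ->
  exists c : R, exists2 N : nat, 0 < c & forall a : {ffun 'I_d -> nat},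
    (forall i, N <= a i)%N -> c <= dot mu (fun x => \1_omega x * hermite_rotated A a x)
                                          (fun x => \1_omega x * hermite_rotated A a x).
Proof.
move=> mo T0 AA ctrl; pose m a := dot mu (fun x => \1_omega x * hermite_rotated A a x)
  (fun x => \1_omega x * hermite_rotated A a x).
apply: contrapT => noc.
(* The positivity of the bound is placed under the existential so that [choice] returns a total
   function. Of the lower bounds on the indices only the one at [i0] is kept. *)
have small (cN : R * nat) : exists a : {ffun 'I_d -> nat},
    0 < cN.1 -> (cN.2 <= a i0)%N /\ m a < cN.1.
  case: cN => c N /=; apply: contrapT => h; apply: noc; exists c, N.
    by rewrite ltNge; apply/negP => c0; apply: h; exists [ffun=> 0%N]; rewrite ltNge c0.
  move=> a aN /=; rewrite leNgt; apply/negP => ma; apply: h; by exists a => _; split.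
have {small}[g gP] := choice small.
pose w k : R := 16^-1 ^+ k.
have w0 k : 0 < w k by rewrite exprn_gt0// invr_gt0.
(* Each index exceeds the previous one at [i0]: the multi-indices are distinct, hence the rotated
   functions orthonormal. *)
pose al := fix al k := if k is k'.+1 then g (w k, (al k' i0).+1) else g (w 0%N, 0%N).
have alm k : m (al k) < w k.
  case: k => [|k]; first by have [] := gP (w 0%N, 0%N) (w0 0%N).
  by have [] := gP (w k.+1, (al k i0).+1) (w0 k.+1).
have al_lt k : (al k i0 < al k.+1 i0)%N by have [] := gP (w k.+1, (al k i0).+1) (w0 _).
have al_mono j k : (j < k)%N -> (al j i0 < al k i0)%N.
  exact: (@homo_ltn _ (fun k => al k i0) (fun m n => (m < n)%N) (@ltn_trans) al_lt j k).
have al_inj j k : (al j == al k) = (j == k).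
  apply/eqP/eqP => [|->//] jk; case: (ltngtP j k) => // /al_mono; rewrite jk ltnn//.
pose phi k := hermite_rotated A (al k).
have sphi k : sqint mu (phi k) by exact: sqint_hermite_rotated.
have ophi j k : dot mu (phi j) (phi k) = (j == k)%:R by rewrite dot_hermite_rotated// al_inj.
have [f sf fphi] := orthonormal_series sphi ophi.
have [u [F [uL _ Fsol FT]]] := ctrl (fun=> 0) (fun x => (f x)%:C%C) (L2_real (sqint0 _)) (L2_real sf).
have [_ [_ [_ [_ _ _ [FTL _]]]]] := Fsol T (introT andP (conj T0 (lexx T))).
set M := (\int[(lebesgue_measure \x mu)%E]_p (complex.Re (u p) ^+ 2 + complex.Im (u p) ^+ 2)).
have key k : 2 ^+ k <= M / 2 + T.
  have d0 : 0 < 4^-1 ^+ k :> R by rewrite exprn_gt0// invr_gt0.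
  have := mild_solution_dot_le (al k) mo AA T0 d0 uL Fsol.
  cbv zeta; rewrite -/(phi k) (@ae_eq_dot _ _ _ _ _ f).
  - rewrite fphi -/M ger0_norm ?exprn_ge0 ?invr_ge0// => h.
    have p2 : 0 < 2 ^+ k :> R by rewrite exprn_gt0.
    have E4 : 4 ^+ k = 2 ^+ k * 2 ^+ k :> R by rewrite -exprMn; congr (_ ^+ _); ring.
    have E16 : 16 ^+ k = 2 ^+ k * 2 ^+ k * (2 ^+ k * 2 ^+ k) :> R.
      by rewrite -!exprMn; congr (_ ^+ _); ring.
    have := alm k; move: h; rewrite /w !exprVn E4 E16 /m -/(phi k) invrK.
    move: (dot mu _ _) (2 ^+ k) p2 => v p p0 h hv.
    have p0' : p != 0 by rewrite gt_eqF.
    (* With p = 2^k, the estimate 2^-k <= 4^-k M / 2 + 4^k T v is multiplied by 4^k, and v < 16^-k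
       absorbs the last factor. *)
    have -> : p = p * p * p^-1 by field.
    apply: le_trans (_ : _ <= p * p * ((p * p)^-1 / 2 * M + p * p * T * v)) _.
      by rewrite ler_wpM2l// mulr_ge0// ltW.
    have -> : p * p * ((p * p)^-1 / 2 * M + p * p * T * v) =
        M / 2 + T * (v * (p * p * (p * p))) by field.
    by rewrite lerD2l ler_piMr// -ler_pdivlMr ?mulr_gt0// mul1r ltW.
  - by have [] := L2_sqint FTL => -[].
  - by case: sf.
  - exact: (sphi k).1.
  - by apply: filterS FT => x ->.
have := key (Num.truncn (M / 2 + T)).+1.
apply/negP; rewrite -ltNge.
apply: lt_le_trans (truncnS_gt _) _.
by rewrite -natrX ler_nat ltnW// ltn_expl.
Qed.

End lower_bound.

(** * Density *)

Section density.
Variables (R : realType).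
Local Notation lam := (borel_lebesgue R).
Local Notation leb := (@lebesgue_measure R).
Local Open Scope ereal_scope.

(** One threshold serves all coordinates: each liminf is at least the infimum over the radii beyond
    [r0], and the induction peels off the outermost one. *)
Lemma iterated_liminf_ge n (F : n.-tuple R -> \bar R) (c : \bar R) (r0 : R) :
  (forall r, (forall i, r0 <= tnth r i)%R -> c <= F r) -> c <= iterated_liminf F.
Proof.
elim: n F => [|n IH] F cF; first by apply: cF => -[].
rewrite /= limf_einfE; pose G (r : R) := iterated_liminf (fun v : n.-tuple R => F [tuple of r :: v]).
apply: le_trans (_ : _ <= ereal_inf (G @` [set r | (r0 < r)%R])) _; last first.
  by apply: ereal_sup_ubound; exists [set r | (r0 < r)%R] => //; exists r0; split => //; exact: num_real.
apply: le_ereal_inf_tmp => _ [r /= r0r <-]; apply: IH => v r0v; apply: cF => i.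
case: (unliftP ord0 i) => [j|] ->; first by rewrite tnthS.
by rewrite tnth0 ltW.
Qed.

Variable d : nat.
Local Notation mu := (@lebesgue R d).

Definition tuple_box (r : d.-tuple R) : set (d.-tuple R) :=
  [set t | forall i, (- tnth r i <= tnth t i <= tnth r i)%R].

Lemma tuple_box_indic (r t : d.-tuple R) :
  (\1_(tuple_box r) t = \prod_i \1_(`[- tnth r i, tnth r i]%classic) (tnth t i) :> R)%R.
Proof.
rewrite indicE; have [rt|rt] := boolP (t \in _).
  rewrite big1// => i _; rewrite indicE mem_set//= in_itv/=.
  by rewrite inE in rt; exact: rt.
have [i ri] : exists i, ~~ (- tnth r i <= tnth t i <= tnth r i)%R.
  apply/existsP; apply: contraNT rt; rewrite negb_exists => /forallP rt.
  by rewrite inE => i; have := rt i; rewrite negbK.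
by rewrite (bigD1 i)//= indicE memNset ?mul0r//= in_itv/=; exact/negP.
Qed.

Lemma measurable_tuple_box r : measurable (tuple_box r).
Proof.
apply/(measurable_indicP R); rewrite (funext (tuple_box_indic r)).
apply: (measurable_prod_tnth (f := fun i (x : measurableTypeR R) => (\1_(`[- tnth r i, tnth r i]%classic) x)%R)) => i.
exact: measurable_indic.
Qed.

Lemma lebesgue_symmetric_box (r : d.-tuple R) : (forall i, 0 < tnth r i)%R ->
  mu (symmetric_box r) = (\prod_i (2 * tnth r i))%:E.
Proof.
move=> r0; have mB := measurable_tuple_box r.
transitivity (lam d (tuple_box r)); first exact: lebesgue_borel.
rewrite -[tuple_box r]setIT -integral_indic//.
under eq_integral do rewrite tuple_box_indic.
apply: (@borel_lebesgue_prod _ _ (fun i (x : measurableTypeR R) => (\1_(`[- tnth r i, tnth r i]%classic) x)%R)) => //.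
  by move=> i; exact: measurable_indic.
move=> i; rewrite integral_indic// setIT.
apply: etrans (lebesgue_measure_itv `[- tnth r i, tnth r i]%R) _.
by rewrite /= lte_fin gtrN// -EFinB opprK mulrDl mul1r.
Qed.

Lemma integral_hermite_sqr n : \int[leb]_x (hermite_function n x ^+ 2)%:E = 1.
Proof.
have := integral_hermite_functionM R n n; rewrite eqxx /Rintegral => h.
under eq_integral do rewrite expr2.
rewrite -[LHS]fineK ?h//; apply: integrable_fin_num => //.
exact: integrable_hermite_functionM.
Qed.

(** By Tonelli, the remaining coordinates each contribute a factor 1. *)
Lemma integral_hermite_prod_slice (a : {ffun 'I_d -> nat}) i (S : set (measurableTypeR R)) :
  measurable S ->
  \int[lam d]_t (hermite_prod a t ^+ 2 * \1_S (tnth t i))%:E =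
  \int[leb]_(x in S) (hermite_function (a i) x ^+ 2)%:E.
Proof.
move=> mS; pose f j (x : measurableTypeR R) : R :=
  (hermite_function (a j) x ^+ 2 * (if j == i then \1_S x else 1))%R.
have sqr0 j x : (0 <= hermite_function (a j) x ^+ 2 :> R)%R by exact: sqr_ge0.
have mh j : measurable_fun setT (fun x : measurableTypeR R => hermite_function (a j) x ^+ 2)%R.
  by apply: measurable_funX; exact: measurable_hermite_function.
have Sfin : \int[leb]_(x in S) (hermite_function (a i) x ^+ 2)%:E \is a fin_num.
  rewrite ge0_fin_numE; last by apply: integral_ge0 => x _; rewrite lee_fin.
  apply: le_lt_trans (ltry 1); rewrite -(integral_hermite_sqr (a i)).
  apply: ge0_subset_integral => //; last by move=> x _; rewrite lee_fin.
  by apply/measurable_EFinP.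
transitivity (\int[lam d]_t (\prod_j f j (tnth t j))%:E).
  apply: eq_integral => t _; congr EFin; rewrite big_split/= -(big_mkcond (fun j => j == i)) big_pred1_eq/=.
  by rewrite /hermite_prod -prodrXl.
rewrite (@borel_lebesgue_prod _ _ f (fun j => if j == i then
  fine (\int[leb]_(x in S) (hermite_function (a i) x ^+ 2)%:E) else 1)%R).
- by rewrite -big_mkcond big_pred1_eq fineK.
- move=> j; apply: measurable_funM; first exact: mh.
  by case: (j == i); [exact: measurable_indic|exact: measurable_cst].
- by move=> j x; rewrite mulr_ge0//; case: ifP.
- move=> j; rewrite /f; case: eqP => [->|_]; last by under eq_integral do rewrite mulr1; exact: integral_hermite_sqr.
  rewrite fineK// [RHS]integral_mkcond; apply: eq_integral => x _.
  by rewrite patchE indicE; case: ifP => _; rewrite ?mulr1 ?mulr0.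
Qed.

(** A point of A(omega) is either in the box, hence in [B], where the coordinatewise bounds
    multiply, or has a coordinate beyond its [r_i]; a union bound over the [d] coordinates produces
    d eta. *)
Lemma hermite_rotated_mass_le (omega : set (euclidean R d)) (A : 'M[R]_d)
    (a : {ffun 'I_d -> nat}) (r : d.-tuple R) (B : set (d.-tuple R)) (C eta : R) :
  measurable omega -> (A *m A^T = 1%:M)%R -> measurable B ->
  (tuple_mulmx A @` omega) `&` tuple_box r `<=` B -> (forall i, 0 <= tnth r i)%R ->
  (forall i x, `|x| <= tnth r i -> hermite_function (a i) x ^+ 2 <= C / tnth r i)%R ->
  (forall i, \int[leb]_(x in [set x | (tnth r i < `|x|)%R]) (hermite_function (a i) x ^+ 2)%:E
      <= eta%:E) ->
  (dot mu (fun x => \1_omega x * hermite_rotated A a x)%R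
          (fun x => \1_omega x * hermite_rotated A a x)%R)%:E
    <= (\prod_i (C / tnth r i))%:E * lam d B + (d%:R * eta)%:E.
Proof.
move=> mo AA mB EB r0 hC htail.
have spsi := sqint_indic mo (sqint_hermite_rotated a AA).
pose S i : set (measurableTypeR R) := [set x | (tnth r i < `|x|)%R].
have mS i : measurable (S i).
  rewrite (_ : S i = ~` `[- tnth r i, tnth r i]%classic)%R; last first.
    by apply/funext => x; apply/propext; rewrite /S/= in_itv/= -ler_norml ltNge; split => /negP.
  by apply: measurableC; exact: measurable_itv.
have K0 : (0 <= \prod_i (C / tnth r i))%R.
  apply: prodr_ge0 => i _; apply: le_trans (hC i 0%R _); first exact: sqr_ge0.
  by rewrite normr0.
pose H i (t : d.-tuple R) := (hermite_prod a t ^+ 2 * \1_(S i) (tnth t i))%R.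
have H0 i t : (0 <= H i t)%R by rewrite mulr_ge0 ?sqr_ge0.
have mH i : measurable_fun setT (H i).
  apply: measurable_funM; first by apply: measurable_funX; exact: measurable_hermite_prod.
  have mSi : measurable_fun setT (\1_(S i) : measurableTypeR R -> R) by exact: measurable_indic.
  exact: (measurableT_comp mSi (@measurable_tnth _ R d i)).
(* A majorant in the rotated variable, so that invariance of the measure removes [A] from its
   integral. *)
pose F (t : d.-tuple R) : \bar R :=
  ((\prod_i (C / tnth r i)) * \1_B t)%:E + \sum_i (H i t)%:E.
have F0 t : 0 <= F t.
  by rewrite adde_ge0 ?lee_fin ?mulr_ge0// sume_ge0// => i _; rewrite lee_fin.
have mB1 : measurable_fun setT (fun t => ((\prod_i (C / tnth r i)) * \1_B t)%:E).
  by apply/measurable_EFinP; apply: measurable_funM => //; exact: measurable_indic.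
have mH1 i : measurable_fun setT (fun t => (H i t)%:E) by exact/measurable_EFinP.
have mF : measurable_fun setT F.
  by apply: emeasurable_funD => //; exact: emeasurable_sum.
apply: le_trans (_ : _ <= \int[mu]_x F (tuple_mulmx A x)) _.
  rewrite -dotE//; apply: ge0_le_integral_restrict => //.
    by move=> x _; rewrite lee_fin -expr2 sqr_ge0.
  move=> x _; rewrite indicE; have [xo|xo] := boolP (x \in omega); last by rewrite !mul0r.
  rewrite !mul1r -expr2 /hermite_rotated; set y := tuple_mulmx A x.
  have oy : (tuple_mulmx A @` omega) y by exists x => //; rewrite inE in xo.
  have [ybox|/existsNP[i yi]] := pselect (forall i, `|tnth y i| <= tnth r i)%R.
    have By : B y by apply: EB; split => // i; rewrite -ler_norml.
    rewrite /F indicE mem_set// mulr1 -[leLHS]adde0 leeD//; last first.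
      by rewrite sume_ge0// => i _; rewrite lee_fin.
    rewrite lee_fin /hermite_prod -prodrXl; apply: ler_prod => i _.
    by rewrite sqr_ge0 hC.
  rewrite /F [X in _ + X](bigD1 i)//= addeCA -[leLHS]adde0 leeD//.
    have Sy : S i (tnth y i) by rewrite /S/= ltNge; exact/negP.
    by rewrite lee_fin /H indicE mem_set// mulr1.
  rewrite adde_ge0 ?lee_fin ?mulr_ge0// sume_ge0// => j _; rewrite lee_fin//.
rewrite (@integral_lebesgue_borel _ _ (fun t => F (tuple_mulmx A t)))//; last first.
  exact: measurableT_comp (@measurable_tuple_mulmx R d A).
have sH0 t : 0 <= \sum_i (H i t)%:E by rewrite sume_ge0// => i _; rewrite lee_fin.
have B0 t : 0 <= ((\prod_i (C / tnth r i)) * \1_B t)%:E by rewrite lee_fin mulr_ge0.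
have msH : measurable_fun setT (fun t => \sum_i (H i t)%:E) by exact: emeasurable_sum.
rewrite borel_lebesgue_orthogonal// /F ge0_integralD//.
rewrite leeD//.
  under eq_integral do rewrite EFinM.
  rewrite ge0_integralZl//; last by apply/measurable_EFinP; exact: measurable_indic.
  by rewrite integral_indic// setIT.
rewrite ge0_integral_sum//; last by move=> i t _; rewrite lee_fin.
apply: le_trans (_ : _ <= \sum_(i < d) eta%:E) _.
  apply: lee_sum => i _; rewrite /H integral_hermite_prod_slice//; exact: htail.
by rewrite sumEFin sumr_const card_ord mulr_natl.
Qed.

End density.

Section density_main.
Variables (R : realType) (d : nat).
Local Notation lam := (borel_lebesgue R).
Local Notation mu := (@lebesgue R d).

Lemma box_density_ge (omega : set (euclidean R d)) (A : 'M[R]_d) (c : R) (N : nat) :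
  (0 < d)%N -> measurable omega -> A *m A^T = 1%:M -> 0 < c ->
  (forall a : {ffun 'I_d -> nat}, (forall i, N <= a i)%N ->
    c <= dot mu (fun x => \1_omega x * hermite_rotated A a x)
                (fun x => \1_omega x * hermite_rotated A a x)) ->
  exists2 c' : R, 0 < c' & exists r0 : R, forall r : d.-tuple R, (forall i, r0 <= tnth r i) ->
    (c'%:E <= box_density (matrix_action A @` omega) r)%E.
Proof.
move=> d0 mo AA c0 mass.
have dR0 : 0 < d%:R :> R by rewrite ltr0n.
(* The [d] tails together then weigh at most c / 4. *)
pose eta := c / (4 * d%:R).
have eta0 : 0 < eta by rewrite divr_gt0// mulr_gt0.
have [C C0 /(_ N)[r0 conc]] := hermite_concentration eta0.
have CC0 : 0 < (2 * C) ^+ d by rewrite exprn_gt0// mulr_gt0.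
(* The factors C / r_i times the volume of the box, the product of the 2 r_i, give (2 C)^d. A
   smaller density would leave a mass below c / 4 + c / 4 < c. *)
exists (c / (4 * (2 * C) ^+ d)); first by rewrite divr_gt0// mulr_gt0.
exists r0 => r r0r; have /choice[a aP] := fun i => conc _ (r0r i).
have rp i : 0 < tnth r i by have [] := aP i.
rewrite leNgt; apply/negP; rewrite /box_density lebesgue_symmetric_box//.
set V := \prod_i _; have V0 : 0 < V by apply: prodr_gt0 => i _; rewrite mulr_gt0.
rewrite inver gt_eqF// lte_pdivrMr// -EFinM => /lebesgue_outer_regular[B [mB EB BV]].
pose a' : {ffun 'I_d -> nat} := [ffun i => a i].
have aN i : (N <= a' i)%N by rewrite ffunE; have [] := aP i.
have := mass a' aN; apply/negP; rewrite -ltNge -lte_fin.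
apply: le_lt_trans (@hermite_rotated_mass_le _ _ omega A a' r B C eta mo AA mB EB (fun i => ltW (rp i)) _ _) _.
- by move=> i x xr; rewrite ffunE; have [_ _ + _] := aP i; exact.
- by move=> i; rewrite ffunE; have [] := aP i.
have K0 : 0 < \prod_i (C / tnth r i) by apply: prodr_gt0 => i _; rewrite divr_gt0.
apply: lt_trans (_ : _ < (\prod_i (C / tnth r i))%:E * (c / (4 * (2 * C) ^+ d) * V)%:E + (d%:R * eta)%:E)%E _.
  by rewrite lteD2rE// lte_pmul2l.
rewrite -EFinM -EFinD lte_fin mulrCA -big_split/=.
rewrite (eq_bigr (fun=> 2 * C)) => [|i _]; last by field; rewrite gt_eqF.
rewrite prodr_const card_ord /eta.
have -> : c / (4 * (2 * C) ^+ d) * (2 * C) ^+ d + d%:R * (c / (4 * d%:R)) = c / 2.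
  by field; rewrite !gt_eqF//.
by rewrite ltr_pdivrMr// ltr_pMr// ltr1n.
Qed.

End density_main.

Theorem theorem2p4 (R : realType) (s : R) (d : nat) (hs : 1 <= s)
    (hd : (1 <= d)%N) (omega : set (euclidean R d)) (homega : measurable omega)
    (hcontrol : exists2 T : R, 0 < T &
      exactly_controllable (@frac_harmonic_group R d s) omega T) :
  forall A : 'M[R]_d, A *m A^T = 1%:M ->
    (0 < iterated_liminf (box_density (matrix_action A @` omega)))%E.
Proof.
move=> A AA; have [T T0 ctrl] := hcontrol.
have [c [N c0 mass]] := controllable_hermite_mass (Ordinal hd) homega (ltW T0) AA ctrl.
have [c' c'0 [r0 dens]] := box_density_ge hd homega AA c0 mass.
apply: lt_le_trans (iterated_liminf_ge dens).
by rewrite lte_fin.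
Qed.
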